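(* Let $m\ge1$. Let $F$ be a proper rational boundary component of $\mathfrak h_n$ of rank $n-1$, let $\gamma\in\Gamma(4m)$, and suppose $F^\gamma\neq\emptyset$. Then $F^\gamma$ is contained in the closure, in the Satake partial compactification $\overline{\mathfrak h}_n$, of the set $\bigcup_{\gamma'\in\Gamma(4m)}\mathfrak h_n^{\gamma'}$.
   Context: $\mathbf{Sp}(2n,\mathbb R)$: real matrices $g=\begin{pmatrix}A&B\\C&D\end{pmatrix}$ with ${}^tgJg=J$, $J=\begin{pmatrix}0&I\\-I&0\end{pmatrix}$, acting on $\mathfrak h_n=\{Z\in M_n(\mathbb C):{}^tZ=Z,\mathrm{Im}Z>0\}$ by $gZ=(AZ+B)(CZ+D)^{-1}$. $\tau\begin{pmatrix}A&B\\C&D\end{pmatrix}=\begin{pmatrix}A&-B\\-C&D\end{pmatrix}$ and $\tau(Z)=-\overline Z$; $\mathfrak h_n^\gamma=\{Z:\gamma Z=\tau(Z)\}$. $\Gamma(4m)=\{\gamma\in\mathbf{Sp}(2n,\mathbb Z):\gamma\equiv I\bmod 4m\}$. $\overline{\mathfrak h}_n$ is the Satake partial compactification (all rational boundary components attached, Satake topology), on which $\mathbf{Sp}(2n,\mathbb Q)$ acts and to which $\tau$ extends with $\tau(gx)=\tau(g)\tau(x)$. For $1\le q<n$ the standard boundary component $F_q$ is the image of $\mathfrak h_q$ under $Z\mapsto\lim_Y\begin{pmatrix}Z&0\\0&iY\end{pmatrix}$, the limit taken as the positive definite $(n-q)\times(n-q)$ matrix $Y$ goes to infinity (all eigenvalues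 $\to\infty$); a rational boundary component of rank $q$ is a set $gF_q$ with $g\in\mathbf{Sp}(2n,\mathbb Q)$. For a boundary component $F$ and $\gamma$, $F^\gamma=\{x\in F:\tau(x)=\gamma x\}$. *)

(* Defs.v *)
From HB Require Import structures.
From mathcomp Require Import all_boot all_order all_algebra.
From mathcomp Require Import complex reals.
Set Implicit Arguments. Unset Strict Implicit. Unset Printing Implicit Defensive.
Import Order.TTheory GRing.Theory Num.Theory.
Local Open Scope ring_scope.

Section Siegel.
Variable R : realType.
Local Notation C := (complex R).

Definition toCmx (p q : nat) (M : 'M[R]_(p, q)) : 'M[C]_(p, q) :=
  map_mx (fun x => Complex x 0) M.

Definition ReM (p q : nat) (Z : 'M[C]_(p, q)) : 'M[R]_(p, q) := map_mx (@complex.Re R) Z.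
Definition ImM (p q : nat) (Z : 'M[C]_(p, q)) : 'M[R]_(p, q) := map_mx (@complex.Im R) Z.

Definition Jmx (p : nat) : 'M[R]_(p + p) := block_mx 0 1%:M (- 1%:M) 0.
Definition symplectic (p : nat) (g : 'M[R]_(p + p)) : Prop := g^T *m Jmx p *m g = Jmx p.

Definition posdef (p : nat) (Y : 'M[R]_p) : Prop :=
  Y^T = Y /\ forall v : 'rV[R]_p, v != 0 -> 0 < (v *m Y *m v^T) 0 0.

Definition in_h (p : nat) (Z : 'M[C]_p) : Prop := Z^T = Z /\ posdef (ImM Z).

Definition sp_act (p : nat) (g : 'M[R]_(p + p)) (Z : 'M[C]_p) : 'M[C]_p :=
  (toCmx (ulsubmx g) *m Z + toCmx (ursubmx g)) *m
  invmx (toCmx (dlsubmx g) *m Z + toCmx (drsubmx g)).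

Definition tau_g (p : nat) (g : 'M[R]_(p + p)) : 'M[R]_(p + p) :=
  block_mx (ulsubmx g) (- ursubmx g) (- dlsubmx g) (drsubmx g).
Definition tau_Z (p : nat) (Z : 'M[C]_p) : 'M[C]_p := - map_mx (@conjc R) Z.

Definition h_fix (p : nat) (gam : 'M[R]_(p + p)) (Z : 'M[C]_p) : Prop :=
  in_h Z /\ sp_act gam Z = tau_Z Z.

Definition in_Gamma (m p : nat) (gam : 'M[R]_(p + p)) : Prop :=
  symplectic gam /\
  forall i j, exists z : int, gam i j - (1%:M : 'M[R]_(p + p)) i j = ((4 * m)%:Z * z)%:~R.

Definition h_union (m p : nat) (Z : 'M[C]_p) : Prop :=
  exists gam', in_Gamma m gam' /\ h_fix gam' Z.

Definition rational_mx (p : nat) (g : 'M[R]_(p + p)) : Prop :=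
  forall i j, exists r : rat, g i j = ratr r.

(* Rank-(n-1) boundary components, n = k + 1.                          *)
(* The standard component F_k is the image of h_k under                *)
(*   Z |-> lim_{y -> oo} diag(Z, i y);                                  *)
(* it corresponds to the isotropic line W = Q e_n (e_n = last vector   *)
(* of the first n coordinates).  A point of a rational boundary        *)
(* component of rank k is written g . F_k(Z) with g in Sp(2n,Q),        *)
(* Z in h_k.                                                            *)

Definition e_last (k : nat) : 'I_((k + 1) + (k + 1)) := lshift (k + 1) (cast_ord (esym (addn1 k)) (@ord_max k)).

(* h stabilizes the standard boundary component F_k, i.e. the line Q e_n *)
Definition stabF (k : nat) (h : 'M[R]_((k + 1) + (k + 1))) : Prop :=
  forall i, i != e_last k -> h i (e_last k) = 0.

(* the induced element of Sp(2k) acting on F_k = h_k: [[A11,B11],[C11,D11]] *)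
Definition levi (k : nat) (h : 'M[R]_((k + 1) + (k + 1))) : 'M[R]_(k + k) :=
  block_mx (ulsubmx (ulsubmx h)) (ulsubmx (ursubmx h))
           (ulsubmx (dlsubmx h)) (ulsubmx (drsubmx h)).

(* g . F_k(Z) = g' . F_k(Z') as points of the Satake partial compactification *)
Definition bd_eq (k : nat) (g : 'M[R]_((k + 1) + (k + 1))) (Z : 'M[C]_k)
    (g' : 'M[R]_((k + 1) + (k + 1))) (Z' : 'M[C]_k) : Prop :=
  stabF (invmx g *m g') /\ Z = sp_act (levi (invmx g *m g')) Z'.

(* x = g . F_k(Z0) lies in F^gamma (F = g F_k): tau(x) = gamma x, where
   tau(g . F_k(Z)) = tau(g) . F_k(tau Z) and gamma (g . F_k(Z)) = (gamma g) . F_k(Z) *)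
Definition bd_fixed (k : nat) (gam g : 'M[R]_((k + 1) + (k + 1))) (Z : 'M[C]_k) : Prop :=
  bd_eq (tau_g g) (tau_Z Z) (gam *m g) Z.

Definition height (k : nat) (Z : 'M[C]_(k + 1)) : R :=
  let Y := ImM Z in
  (drsubmx Y - dlsubmx Y *m invmx (ulsubmx Y) *m ursubmx Y) 0 0.

(* Basic Satake neighbourhood (intersected with h_n) of the point F_k(Z0)
   of the standard boundary component:
   { Z in h_n : Z1 is eps-close to Z0, height Z > t }. *)
Definition satake_nbhd (k : nat) (Z0 : 'M[C]_k) (eps t : R) (Z : 'M[C]_(k + 1)) : Prop :=
  in_h Z /\ (forall i j, `|ulsubmx Z i j - Z0 i j| < Complex eps 0) /\ t < height Z.

(* The point x = g . F_k(Z0) lies in the closure, in the Satake partial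
   compactification (Satake topology defined with respect to Gamma(4m)),
   of a set S of points of h_{k+1}: every neighbourhood of x meets S, where
   a fundamental system of neighbourhoods of x (traced on h_n) is given by
   the Gamma(4m)_x-saturations of the translates g . satake_nbhd Z0 eps t. *)
Definition in_satake_closure (m k : nat) (S : 'M[C]_(k + 1) -> Prop)
    (g : 'M[R]_((k + 1) + (k + 1))) (Z0 : 'M[C]_k) : Prop :=
  forall eps t : R, 0 < eps ->
    exists delta : 'M[R]_((k + 1) + (k + 1)),
      in_Gamma m delta /\ bd_eq (delta *m g) Z0 g Z0 /\
      exists Z, satake_nbhd Z0 eps t Z /\ S (sp_act (delta *m g) Z).

End Siegel.

(* Main.v *)
Require Import Defs.
From HB Require Import structures.
From mathcomp Require Import all_boot all_order all_algebra.
From mathcomp Require Import complex reals.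
From mathcomp Require Import ring lra.
Set Implicit Arguments. Unset Strict Implicit. Unset Printing Implicit Defensive.
Import Order.TTheory GRing.Theory Num.Theory.
Local Open Scope ring_scope.

(** Put D = diag(1, -1), so that tau(g) = D g D, and T = D gam: an integral antisymplectic map.
    A point [g . F_k(Z0)] lies in F^gam iff P = g^-1 T g multiplies the line [e] of F_k by some
    [a] and the map induced on e^perp / e, composed with complex conjugation, fixes Z0.
    Since T and T^-1 are integral and [e] is rational, a = 1 or a = -1. As gam = 1 mod 4m,
    T^2 = 1 + 8m N with N integral. On e^perp / e the map T^2 is an isometry of a positive
    definite form, so N contracts there and its powers tend to 0; being integral they vanish, and
    a unipotent isometry is the identity. Hence U = T^2 - 1 satisfies U^3 = 0, the matrix
    S = (1 + U)^(-1/2) = 1 - U/2 + 3 U^2/8 is symplectic and congruent to 1 mod 4m, and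
    gam' = gam S lies in Gamma(4m) with (D gam')^2 = 1 and the same action on F_k.
    For the antisymplectic involution P' = g^-1 D gam' g a vector [f'] dual to [e] can be chosen
    with P' f' = -a f'. The unipotent map fixing [e] and sending [f] to [f'] splits P', and moves
    the points diag(Z0, i y) to fixed points of P' of height y over Z0, for every y > 0. *)

(** * Entries of linear combinations of matrices *)

Lemma mxDE (V : zmodType) p q (A B : 'M[V]_(p, q)) i j : (A + B) i j = A i j + B i j.
Proof. by rewrite mxE. Qed.

Lemma mxNE (V : zmodType) p q (A : 'M[V]_(p, q)) i j : (- A) i j = - A i j.
Proof. by rewrite mxE. Qed.

Lemma mxZE (V : pzRingType) p q (a : V) (A : 'M[V]_(p, q)) i j : (a *: A) i j = a * A i j.
Proof. by rewrite mxE. Qed.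

Definition mx_linE := (mxDE, mxNE, mxZE).

(** * Positive definite forms and their isometries *)

Section PositiveForms.
Variables (R : realType) (p : nat).
Implicit Types (G M : 'M[R]_p) (r s v : 'rV[R]_p).

Lemma form_sym G r s : G^T = G -> (r *m G *m s^T) 0 0 = (s *m G *m r^T) 0 0.
Proof.
move=> symG; have -> : s *m G *m r^T = (r *m G *m s^T)^T; last by rewrite [RHS]mxE.
by rewrite !trmx_mul symG trmxK mulmxA.
Qed.

Lemma posdef_ge0 G r : posdef G -> 0 <= (r *m G *m r^T) 0 0.
Proof.
case=> _ posG; have [->|/posG/ltW//] := eqVneq r 0.
by rewrite !mul0mx mxE.
Qed.

Lemma posdef_unit G : posdef G -> G \in unitmx.
Proof.
case=> _ posG; rewrite -row_free_unit -kermx_eq0; apply/rowV0P => v /sub_kermxP vG0.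
by apply/eqP; apply: contraT => /posG; rewrite vG0 mul0mx mxE ltxx.
Qed.

Lemma posdef_inv G : posdef G -> posdef (invmx G).
Proof.
move=> pG; have uG := posdef_unit pG; case: pG => symG posG.
split=> [|v v0]; first by rewrite trmx_inv symG.
have: v *m invmx G != 0.
  by apply: contra v0 => /eqP vG; rewrite -[v](mulmxKV uG) vG mul0mx.
by move/posG; rewrite mulmxKV // trmx_mul trmx_inv symG mulmxA.
Qed.

Lemma form_cauchy_schwarz G r s : posdef G ->
  (r *m G *m s^T) 0 0 ^+ 2 <= (r *m G *m r^T) 0 0 * (s *m G *m s^T) 0 0.
Proof.
move=> pG; have [->|s0] := eqVneq s 0; first by rewrite trmx0 !mulmx0 !mxE expr0n mulr0.
(* The test vector is a multiple of the component of [r] orthogonal to [s]. *)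
have := posdef_ge0 ((s *m G *m s^T) 0 0 *: r - (r *m G *m s^T) 0 0 *: s) pG.
case: pG => symG posG; have := posG _ s0; have := form_sym r s symG.
set a := (r *m G *m r^T) 0 0; set b := (r *m G *m s^T) 0 0.
set b' := (s *m G *m r^T) 0 0; set c := (s *m G *m s^T) 0 0 => eb c0.
have -> : ((c *: r - b *: s) *m G *m (c *: r - b *: s)^T) 0 0 = c * (a * c - b ^+ 2).
  have -> : (c *: r - b *: s)^T = c *: r^T - b *: s^T by rewrite linearB /= !linearZ.
  rewrite !mulmxBl !mulmxBr -!scalemxAl -!scalemxAr !scalerA.
  by rewrite !mx_linE -/a -/b -/b' -/c -eb; ring.
by rewrite pmulr_rge0 // subr_ge0.
Qed.

Lemma isometry_form G M r s : M *m G *m M^T = G ->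
  (r *m M *m G *m (s *m M)^T) 0 0 = (r *m G *m s^T) 0 0.
Proof. by move=> iso; rewrite trmx_mul -[in RHS]iso !mulmxA. Qed.

(** Parallelogram law: the values of the form at [r M - r] and [r M + r] add up to [4] times its
    value at [r], and the second one is nonnegative. *)
Lemma isometry_sub1_form_le G M r : posdef G -> M *m G *m M^T = G ->
  (r *m (M - 1%:M) *m G *m (r *m (M - 1%:M))^T) 0 0 <= 4 * (r *m G *m r^T) 0 0.
Proof.
move=> pG iso; have := posdef_ge0 (r *m M + r) pG.
have -> : r *m (M - 1%:M) = r *m M - r by rewrite mulmxBr mulmx1.
have := isometry_form r r iso; set rM := r *m M.
have -> : (rM + r)^T = rM^T + r^T by rewrite linearD.
have -> : (rM - r)^T = rM^T - r^T by rewrite linearB.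
rewrite !mulmxDl !mulmxDr !mulNmx !mulmxN.
rewrite !mx_linE; lra.
Qed.

(** Each factor multiplies the form by at most [4 / c ^+ 2], hence by at most [1 / 16]; the cruder
    ratio [1 / 2] is enough for a geometric decay. *)
Lemma isometry_sub1_expr_le G M r (c : R) j : posdef G -> M *m G *m M^T = G -> 8 <= c ->
  (r *m (c^-1 *: (M - 1%:M)) ^+ j *m G *m (r *m (c^-1 *: (M - 1%:M)) ^+ j)^T) 0 0
    <= (2^-1) ^+ j * (r *m G *m r^T) 0 0.
Proof.
move=> pG iso c8; elim: j r => [|j IH] r; first by rewrite !expr0 mul1r mulmx1.
rewrite exprS -mulmxE mulmxA; apply: (le_trans (IH _)).
rewrite exprSr -mulrA ler_pM2l ?exprn_gt0 ?invr_gt0 //.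
rewrite -!scalemxAr -!scalemxAl linearZ /= -!scalemxAr scalerA mxE.
have le4 := isometry_sub1_form_le r pG iso.
apply: le_trans (_ : c^-1 * c^-1 * (4 * (r *m G *m r^T) 0 0) <= _).
  by rewrite ler_wpM2l // mulr_ge0 // invr_ge0; lra.
have ge0 := posdef_ge0 r pG.
have ci : c^-1 <= 8^-1 by rewrite lef_pV2 // posrE; lra.
have c0 : 0 < c^-1 by rewrite invr_gt0; lra.
rewrite mulrA ler_wpM2r //; nra.
Qed.

(** A vector fixed by an isometry is orthogonal to the image of [M - 1]. A nonzero row of the last
    nonvanishing power would be both fixed and in that image, hence isotropic, against definiteness;
    so the exponent can be lowered step by step. *)
Lemma isometry_unipotent G M j : posdef G -> M *m G *m M^T = G ->
  (M - 1%:M) ^+ j.+1 = 0 -> M = 1%:M.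
Proof.
move=> pG iso; elim: j => [|j IH] nil; first by apply/eqP; rewrite -subr_eq0; apply/eqP.
apply: IH; apply/row_matrixP => i; rewrite row0; apply/eqP; apply: contraT.
set s := row i _ => s0; case: (pG) => _ /(_ _ s0).
have sM : s *m M = s.
  apply/eqP; rewrite -subr_eq0 -{2}[s]mulmx1 -mulmxBr /s -row_mul.
  by rewrite mulmxE -exprSr nil row0.
have [r sE] : exists r, s = r *m M - r.
  exists (row i ((M - 1%:M) ^+ j)); rewrite -{2}[row _ _]mulmx1 -mulmxBr -row_mul.
  by rewrite mulmxE -exprSr.
rewrite {1}sE -{1}sM mulmxBl mulmxBl !mx_linE isometry_form //.
by rewrite sM subrr ltxx.
Qed.

End PositiveForms.

(** * Complex matrices and Hermitian positivity *)

Section SiegelSpace.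
Variable R : realType.
Local Notation C := (complex R).
Local Notation ReM := (@Defs.ReM R _ _).
Local Notation ImM := (@Defs.ImM R _ _).

Definition conj_mx p q (M : 'M[C]_(p, q)) : 'M[C]_(p, q) := map_mx (@conjc R) M.

Lemma toCmxM p q r (A : 'M[R]_(p, q)) (B : 'M[R]_(q, r)) : toCmx (A *m B) = toCmx A *m toCmx B.
Proof. exact: (map_mxM (real_complex R)). Qed.

Lemma toCmxD p q (A B : 'M[R]_(p, q)) : toCmx (A + B) = toCmx A + toCmx B.
Proof. exact: (map_mxD (real_complex R)). Qed.

Lemma toCmxN p q (A : 'M[R]_(p, q)) : toCmx (- A) = - toCmx A.
Proof. exact: (map_mxN (real_complex R)). Qed.

Lemma toCmxZ p q (a : R) (A : 'M[R]_(p, q)) : toCmx (a *: A) = (Complex a 0) *: toCmx A.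
Proof. exact: (map_mxZ (real_complex R)). Qed.

Lemma toCmx0 p q : toCmx (0 : 'M[R]_(p, q)) = 0.
Proof. exact: (map_mx0 (real_complex R)). Qed.

Lemma toCmx1 p : toCmx (1%:M : 'M[R]_p) = 1%:M.
Proof. exact: (map_mx1 (real_complex R)). Qed.

Lemma toCmx_tr p q (A : 'M[R]_(p, q)) : toCmx A^T = (toCmx A)^T.
Proof. by rewrite /toCmx map_trmx. Qed.

Lemma toCmx_col p1 p2 q (A : 'M[R]_(p1, q)) (B : 'M[R]_(p2, q)) :
  toCmx (col_mx A B) = col_mx (toCmx A) (toCmx B).
Proof. exact: map_col_mx. Qed.

Lemma toCmx_block p1 p2 q1 q2 (A : 'M[R]_(p1, q1)) (B : 'M[R]_(p1, q2)) (C : 'M[R]_(p2, q1))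
  (D : 'M[R]_(p2, q2)) :
  toCmx (block_mx A B C D) = block_mx (toCmx A) (toCmx B) (toCmx C) (toCmx D).
Proof. exact: map_block_mx. Qed.

Lemma toCmx_inv p (A : 'M[R]_p) : toCmx (invmx A) = invmx (toCmx A).
Proof. exact: (map_invmx (real_complex R)). Qed.

Lemma conj_mxM p q r (A : 'M[C]_(p, q)) (B : 'M[C]_(q, r)) :
  conj_mx (A *m B) = conj_mx A *m conj_mx B.
Proof. exact: map_mxM. Qed.

Lemma conj_mxD p q (A B : 'M[C]_(p, q)) : conj_mx (A + B) = conj_mx A + conj_mx B.
Proof. exact: map_mxD. Qed.

Lemma conj_mx1 p : conj_mx (1%:M : 'M[C]_p) = 1%:M.
Proof. exact: map_mx1. Qed.

Lemma conj_mx_tr p q (A : 'M[C]_(p, q)) : conj_mx A^T = (conj_mx A)^T.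
Proof. by rewrite /conj_mx map_trmx. Qed.

Lemma conj_mx_col p1 p2 q (A : 'M[C]_(p1, q)) (B : 'M[C]_(p2, q)) :
  conj_mx (col_mx A B) = col_mx (conj_mx A) (conj_mx B).
Proof. exact: map_col_mx. Qed.

Lemma conj_mx_row p q1 q2 (A : 'M[C]_(p, q1)) (B : 'M[C]_(p, q2)) :
  conj_mx (row_mx A B) = row_mx (conj_mx A) (conj_mx B).
Proof. exact: map_row_mx. Qed.

Lemma conj_mxZ p q (a : C) (A : 'M[C]_(p, q)) : conj_mx (a *: A) = conjc a *: conj_mx A.
Proof. exact: map_mxZ. Qed.

Lemma toCmx_row p q1 q2 (A : 'M[R]_(p, q1)) (B : 'M[R]_(p, q2)) :
  toCmx (row_mx A B) = row_mx (toCmx A) (toCmx B).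
Proof. exact: map_row_mx. Qed.

Lemma conj_mxK p q (A : 'M[C]_(p, q)) : conj_mx (conj_mx A) = A.
Proof. by apply/matrixP => i j; rewrite !mxE conjcK. Qed.

Lemma conj_mx_toC p q (A : 'M[R]_(p, q)) : conj_mx (toCmx A) = toCmx A.
Proof. by apply/matrixP => i j; rewrite !mxE /= oppr0. Qed.

Lemma conj_mx_unit p (A : 'M[C]_p) : (conj_mx A \in unitmx) = (A \in unitmx).
Proof. exact: map_unitmx. Qed.

Lemma ReImM p q (A : 'M[C]_(p, q)) : A = toCmx (ReM A) + 'i%C *: toCmx (ImM A).
Proof. by apply/matrixP => i j; rewrite !mxE [LHS]complexE. Qed.

Lemma ImM_ReIm p q (A B : 'M[R]_(p, q)) : ImM (toCmx A + 'i%C *: toCmx B) = B.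
Proof. by apply/matrixP => i j; rewrite !mxE /=; ring. Qed.

Lemma sub_conj_mx p q (A : 'M[C]_(p, q)) : A - conj_mx A = (2 * 'i%C) *: toCmx (ImM A).
Proof.
apply/matrixP => i j; rewrite !mxE; case: (A i j) => a b /=.
by apply/eqP; rewrite eq_complex /=; apply/andP; split; apply/eqP; ring.
Qed.

Lemma toCmx_inj p q : injective (@toCmx R p q).
Proof. by move=> A B /matrixP eqAB; apply/matrixP => i j; have := eqAB i j; rewrite !mxE => -[]. Qed.

(** For [u = a + i b] the cross terms cancel by symmetry of [Y], leaving the real form at [a] plus
    the real form at [b]. The order on complex numbers also demands that the imaginary part
    vanish. *)
Lemma herm_pos p (Y : 'M[R]_p) (u : 'rV[C]_p) : posdef Y -> u != 0 ->
  0 < (u *m toCmx Y *m (conj_mx u)^T) 0 0.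
Proof.
move=> pY u0; set a := ReM u; set b := ImM u.
have -> : u *m toCmx Y *m (conj_mx u)^T =
          toCmx (a *m Y *m a^T + b *m Y *m b^T) +
          'i%C *: toCmx (b *m Y *m a^T - a *m Y *m b^T).
  have -> : conj_mx u = toCmx a - 'i%C *: toCmx b.
    apply/matrixP => i j; rewrite !mxE; case: (u i j) => x y /=.
    by apply/eqP; rewrite eq_complex /=; apply/andP; split; apply/eqP; ring.
  rewrite {1}(ReImM u) -/a -/b.
  have -> : (toCmx a - 'i%C *: toCmx b)^T = toCmx a^T - 'i%C *: toCmx b^T.
    by rewrite linearB /= linearZ /= !toCmx_tr.
  rewrite !toCmxD !toCmxN !toCmxM !mulmxDl !mulmxDr !mulmxN -!scalemxAl -!scalemxAr.
  by apply/matrixP => i j; rewrite !mx_linE; have := sqr_i R; rewrite expr2 => ii; ring: ii.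
have eb := form_sym a b pY.1.
have -> : b *m Y *m a^T - a *m Y *m b^T = 0.
  by apply/matrixP => i j; rewrite !ord1 !mx_linE eb subrr mxE.
rewrite toCmx0 scaler0 addr0 [X in _ < X]mxE ltcE /= eqxx /=.
have [a0|a0] := eqVneq a 0; last first.
  by rewrite mxDE ltr_pwDl ?posdef_ge0 //; case: pY => _; apply.
have [b0|b0] := eqVneq b 0; last first.
  by rewrite mxDE ltr_wpDl ?posdef_ge0 //; case: pY => _; apply.
by move: u0; rewrite (ReImM u) -/a -/b a0 b0 !toCmx0 scaler0 addr0 eqxx.
Qed.

(** * Lagrangian frames and the symplectic action *)

Definition frame p (Z : 'M[C]_p) : 'M[C]_(p + p, p) := col_mx Z 1%:M.

Definition Dmx p : 'M[R]_(p + p) := block_mx 1%:M 0 0 (- 1%:M).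

Definition antisymplectic p (P : 'M[R]_(p + p)) := P^T *m Jmx R p *m P = - Jmx R p.

Lemma col_Jmx p (X1 X2 Y1 Y2 : 'M[C]_p) :
  (col_mx X1 X2)^T *m toCmx (Jmx R p) *m col_mx Y1 Y2 = X1^T *m Y2 - X2^T *m Y1.
Proof.
rewrite /Jmx toCmx_block !toCmx0 toCmxN toCmx1 tr_col_mx mul_row_block mul_row_col.
by rewrite !mulmx0 add0r addr0 !mulmxN !mulmx1 mulNmx addrC.
Qed.

(** The Hermitian form attached to [Jmx] reads off [ImM Z] from the frame, so its invariance under
    symplectic maps controls positivity. *)
Lemma frame_herm p (Z : 'M[C]_p) : Z^T = Z ->
  (frame Z)^T *m toCmx (Jmx R p) *m conj_mx (frame Z) = (2 * 'i%C) *: toCmx (ImM Z).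
Proof.
by move=> symZ; rewrite conj_mx_col col_Jmx conj_mx1 mulmx1 trmx1 mul1mx symZ sub_conj_mx.
Qed.

Lemma i2_neq0 : (2 * 'i%C : C) != 0.
Proof. by rewrite eq_complex /=; apply/negP => /andP[_ /eqP]; lra. Qed.

Lemma symplectic_herm p (g : 'M[R]_(p + p)) (X : 'M[C]_(p + p, p)) : symplectic g ->
  (toCmx g *m X)^T *m toCmx (Jmx R p) *m conj_mx (toCmx g *m X) =
  X^T *m toCmx (Jmx R p) *m conj_mx X.
Proof.
by move=> sg; rewrite conj_mxM conj_mx_toC -[in RHS]sg !toCmxM toCmx_tr trmx_mul !mulmxA.
Qed.

Lemma symplectic_bil p (g : 'M[R]_(p + p)) (X : 'M[C]_(p + p, p)) : symplectic g ->
  (toCmx g *m X)^T *m toCmx (Jmx R p) *m (toCmx g *m X) = X^T *m toCmx (Jmx R p) *m X.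
Proof.
by move=> sg; rewrite -[in RHS]sg !toCmxM toCmx_tr trmx_mul !mulmxA.
Qed.

(** A null vector [u] of the transposed denominator makes the Hermitian form of the transformed
    frame vanish at [u]. By invariance that value is [2 i] times the one of [ImM Z], which is
    positive unless [u] is zero. *)
Lemma symplectic_frame_unit p (g : 'M[R]_(p + p)) (Z : 'M[C]_p) : symplectic g -> in_h Z ->
  dsubmx (toCmx g *m frame Z) \in unitmx.
Proof.
move=> sg [symZ pY]; rewrite -unitmx_tr -row_free_unit -kermx_eq0.
apply/rowV0P => u /sub_kermxP uQ; apply/eqP; apply: contraT => /(herm_pos pY) pos.
have := symplectic_herm (frame Z) sg; rewrite frame_herm //.
rewrite -[toCmx g *m frame Z]vsubmxK conj_mx_col col_Jmx.
set Q := dsubmx _ in uQ *; set X := usubmx _.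
have cQu : conj_mx Q *m (conj_mx u)^T = 0.
  by rewrite -[conj_mx Q]trmxK -trmx_mul -conj_mx_tr -conj_mxM uQ /conj_mx map_mx0 trmx0.
move/(congr1 (fun M => u *m M *m (conj_mx u)^T)).
rewrite mulmxBr mulmxBl (mulmxA u Q^T) uQ !mul0mx subr0 -!mulmxA cQu !mulmx0 mulmxA.
rewrite -scalemxAr -scalemxAl => /esym/eqP; rewrite scaler_eq0 (negPf i2_neq0) /= => /eqP eq0.
by move: pos; rewrite eq0 mxE ltxx.
Qed.

Lemma toCmx_mul_frame p (g : 'M[R]_(p + p)) (Z : 'M[C]_p) :
  toCmx g *m frame Z =
  col_mx (toCmx (ulsubmx g) *m Z + toCmx (ursubmx g)) (toCmx (dlsubmx g) *m Z + toCmx (drsubmx g)).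
Proof. by rewrite -{1}[g]submxK toCmx_block mul_block_col !mulmx1. Qed.

(** The columns of [frame Z] span the Lagrangian subspace that [Z] represents. The fractional linear
    action is multiplication of this subspace by [g], and the right factor is the denominator
    [C Z + D]. *)
Lemma sp_act_frame p (g : 'M[R]_(p + p)) (Z : 'M[C]_p) : symplectic g -> in_h Z ->
  exists2 Q, Q \in unitmx & toCmx g *m frame Z = frame (sp_act g Z) *m Q.
Proof.
move=> sg hZ; have := symplectic_frame_unit sg hZ; rewrite toCmx_mul_frame col_mxKd => uQ.
by exists (toCmx (dlsubmx g) *m Z + toCmx (drsubmx g)); rewrite // mul_col_mx mul1mx mulmxKV.
Qed.

Lemma sp_act_frameP p (g : 'M[R]_(p + p)) (Z Z' : 'M[C]_p) Q : symplectic g -> in_h Z ->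
  toCmx g *m frame Z = frame Z' *m Q -> sp_act g Z = Z'.
Proof.
move=> sg hZ; have := symplectic_frame_unit sg hZ; rewrite toCmx_mul_frame col_mxKd => uQ.
rewrite mul_col_mx mul1mx => /eq_col_mx[eZ eQ].
by rewrite /sp_act eZ -eQ mulmxK.
Qed.

(** Invariance of the bilinear form of [Jmx] gives symmetry of the image; invariance of the
    Hermitian form gives [eY], along which positivity is transported by the invertible [Q]. *)
Lemma sp_act_in_h p (g : 'M[R]_(p + p)) (Z : 'M[C]_p) : symplectic g -> in_h Z ->
  in_h (sp_act g Z).
Proof.
move=> sg hZ; have [Q uQ eQ] := sp_act_frame sg hZ; have [symZ pY] := hZ.
set Z' := sp_act g Z in eQ *.
have uQT : Q^T \in unitmx by rewrite unitmx_tr.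
have symZ' : Z'^T = Z'.
  have := symplectic_bil (frame Z) sg; rewrite eQ trmx_mul !mulmxA -(mulmxA Q^T) -(mulmxA Q^T).
  rewrite !col_Jmx !mulmx1 trmx1 !mul1mx symZ subrr => /(congr1 (mulmx^~ (invmx Q))).
  rewrite mulmxK // mul0mx => /(congr1 (mulmx (invmx Q^T))).
  by rewrite mulKmx // mulmx0 => /eqP; rewrite subr_eq0 => /eqP.
have uC : conj_mx Q \in unitmx by rewrite conj_mx_unit.
have eY : Q^T *m toCmx (ImM Z') *m conj_mx Q = toCmx (ImM Z).
  apply/eqP; rewrite -(inj_eq (scalerI i2_neq0)) scalemxAl scalemxAr; apply/eqP.
  rewrite -!frame_herm // -[in RHS](symplectic_herm (frame Z) sg) eQ conj_mxM trmx_mul.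
  by rewrite !mulmxA.
split=> //; split=> [|v v0]; first by rewrite /ImM map_trmx symZ'.
pose u := toCmx v *m invmx Q^T.
have u0 : u != 0.
  apply: contra v0 => /eqP/(congr1 (mulmx^~ Q^T)); rewrite mulmxKV // mul0mx.
  by rewrite -(toCmx0 1 p) => /toCmx_inj ->.
have := herm_pos pY u0; rewrite -eY !mulmxA /u mulmxKV // conj_mxM conj_mx_toC trmx_mul.
have -> : (conj_mx (invmx Q^T))^T = invmx (conj_mx Q).
  by rewrite -trmx_inv conj_mx_tr trmxK /conj_mx map_invmx.
by rewrite !mulmxA mulmxK // -toCmx_tr -!toCmxM mxE ltcE => /andP[].
Qed.

Lemma DmxK p : Dmx p *m Dmx p = 1%:M.
Proof.
rewrite /Dmx mulmx_block !mul0mx !mulmx0 !addr0 add0r mulmx1 mulmxN mulNmx opprK mulmx1.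
by rewrite -scalar_mx_block.
Qed.

Lemma tr_Dmx p : (Dmx p)^T = Dmx p.
Proof. by rewrite /Dmx tr_block_mx !trmx0 trmx1 linearN /= trmx1. Qed.

Lemma Dmx_anti p : antisymplectic (Dmx p).
Proof.
rewrite /antisymplectic tr_Dmx /Dmx /Jmx !mulmx_block !(mul0mx, mulmx0, addr0, add0r).
by rewrite !(mulmx1, mul1mx, mulmxN, mulNmx, opprK) opp_block_mx !oppr0 opprK.
Qed.

Lemma tau_gE p (g : 'M[R]_(p + p)) : tau_g g = Dmx p *m g *m Dmx p.
Proof.
rewrite -[in RHS](submxK g) /Dmx /tau_g !mulmx_block !(mul0mx, mulmx0, addr0, add0r).
by rewrite !(mulmx1, mul1mx, mulmxN, mulNmx, opprK).
Qed.

Lemma Dmx_frame p (Z : 'M[C]_p) :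
  toCmx (Dmx p) *m frame (tau_Z Z) = - conj_mx (frame Z).
Proof.
rewrite /Dmx toCmx_block !toCmx0 toCmxN !toCmx1 mul_block_col !mul0mx addr0 add0r.
by rewrite mulNmx !mul1mx conj_mx_col conj_mx1 opp_col_mx.
Qed.

(* For [P = D h] this says that the antiholomorphic map [Z |-> - conj (h Z)] fixes [Z]; in terms
   of [P] the composition of such maps is a plain matrix product. *)
Definition fixes_frame p (P : 'M[R]_(p + p)) (Z : 'M[C]_p) :=
  exists Q, toCmx P *m frame Z = conj_mx (frame Z) *m Q.

Lemma fixes_frameP p (h : 'M[R]_(p + p)) (Z : 'M[C]_p) : symplectic h -> in_h Z ->
  fixes_frame (Dmx p *m h) Z <-> sp_act h Z = tau_Z Z.
Proof.
move=> sh hZ; have DD : toCmx (Dmx p) *m toCmx (Dmx p) = 1%:M by rewrite -toCmxM DmxK toCmx1.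
split=> [[Q]|e].
  rewrite toCmxM -mulmxA => /(congr1 (mulmx (toCmx (Dmx p)))).
  rewrite mulmxA DD mul1mx -[conj_mx _]opprK -Dmx_frame mulNmx mulmxN !mulmxA DD mul1mx -mulmxN.
  exact: sp_act_frameP.
have [Q _] := sp_act_frame sh hZ; rewrite e => eQ; exists (- Q).
by rewrite toCmxM -mulmxA eQ mulmxA Dmx_frame mulNmx mulmxN.
Qed.

Lemma fixes_frame_act p (g P P' : 'M[R]_(p + p)) (Z : 'M[C]_p) : symplectic g -> in_h Z ->
  P' *m g = g *m P -> fixes_frame P Z -> fixes_frame P' (sp_act g Z).
Proof.
move=> sg hZ eP [Q eQ]; have [V uV eV] := sp_act_frame sg hZ.
exists (conj_mx V *m Q *m invmx V).
rewrite !mulmxA -conj_mxM -eV conj_mxM conj_mx_toC -(mulmxA (toCmx g)) -eQ mulmxA -toCmxM -eP.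
by rewrite toCmxM -(mulmxA (toCmx P')) eV mulmxA mulmxK.
Qed.

(** With [X = frame Z] and [Y = ImM Z], put [H = X Y^-1 X^*]. The map [P] carries [H] to its complex
    conjugate, hence preserves the real part of [H], which is the required positive definite [G]. *)
Lemma fixes_frame_isometry p (P : 'M[R]_(p + p)) (Z : 'M[C]_p) :
  antisymplectic P -> in_h Z -> fixes_frame P Z ->
  exists G, posdef G /\ P *m G *m P^T = G.
Proof.
move=> aP [symZ pY] [Q eQ]; set X := frame Z in eQ; set Y := ImM Z in pY.
have pYi := posdef_inv pY; have uY := posdef_unit pY.
have uYC : toCmx Y \in unitmx by rewrite /toCmx (map_unitmx (real_complex R)).
(* The sign from the antisymplectic relation and the sign from conjugating the frame cancel. *)
have eY : Q^T *m toCmx Y *m conj_mx Q = toCmx Y.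
  apply/eqP; rewrite -(inj_eq (scalerI i2_neq0)) scalemxAl scalemxAr; apply/eqP.
  have herm : (toCmx P *m X)^T *m toCmx (Jmx R p) *m conj_mx (toCmx P *m X) =
      - ((2 * 'i%C) *: toCmx Y).
    rewrite conj_mxM conj_mx_toC trmx_mul -frame_herm // -mulNmx -mulmxN -toCmxN -aP.
    by rewrite !toCmxM toCmx_tr !mulmxA.
  apply: oppr_inj; rewrite -herm eQ conj_mxM conj_mxK trmx_mul !mulmxA -mulNmx -mulmxN.
  rewrite -[Q^T *m _ *m _ *m X]mulmxA -[Q^T *m _ *m (_ *m X)]mulmxA; congr (_ *m _ *m _).
  rewrite -[X in _ = _ *m (_ *m X)]conj_mxK -[toCmx (Jmx R p)]conj_mx_toC mulmxA -conj_mx_tr.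
  rewrite -!conj_mxM frame_herm //; apply/matrixP => i j; rewrite !mxE.
  by apply/eqP; rewrite eq_complex /=; apply/andP; split; apply/eqP; ring.
have eYi : Q *m toCmx (invmx Y) *m (conj_mx Q)^T = toCmx (invmx Y).
  have eY' : (conj_mx Q)^T *m toCmx Y *m Q = toCmx Y.
    by rewrite -[Q in _ *m Q]conj_mxK -[toCmx Y]conj_mx_toC -conj_mx_tr -!conj_mxM eY.
  have : Q *m toCmx (invmx Y) *m (conj_mx Q)^T *m toCmx Y = 1%:M.
    rewrite -!mulmxA mulmx1C // -!mulmxA (mulmxA _ _ Q) eY'.
    by rewrite toCmx_inv mulVmx.
  move/(congr1 (mulmx^~ (invmx (toCmx Y)))); rewrite mulmxK // mul1mx => ->.
  by rewrite toCmx_inv.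
pose H := X *m toCmx (invmx Y) *m (conj_mx X)^T.
have symYi : (invmx Y)^T = invmx Y by case: pYi.
have trH : H^T = conj_mx H.
  by rewrite /H !trmx_mul trmxK -toCmx_tr symYi !conj_mxM conj_mx_toC conj_mx_tr conj_mxK mulmxA.
have eH : toCmx P *m H *m (toCmx P)^T = conj_mx H.
  rewrite /H !mulmxA eQ -mulmxA -trmx_mul -[toCmx P]conj_mx_toC -conj_mxM eQ conj_mxM conj_mxK.
  rewrite trmx_mul !mulmxA !conj_mxM conj_mx_toC conj_mx_tr conj_mxK.
  by rewrite -3!(mulmxA (conj_mx X)) eYi mulmxA.
have reH : toCmx (Defs.ReM H) = 2^-1 *: (H + conj_mx H).
  by apply/matrixP => i j; rewrite !mxE mulrC -ReJ_add.
exists (Defs.ReM H); split; last first.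
  apply: toCmx_inj; rewrite !toCmxM reH toCmx_tr -scalemxAr -scalemxAl; congr (_ *: _).
  rewrite mulmxDr mulmxDl eH addrC; congr (_ + _).
  by rewrite -[toCmx P]conj_mx_toC -conj_mx_tr -!conj_mxM eH conj_mxK.
split=> [|v v0].
  by apply: toCmx_inj; rewrite toCmx_tr reH linearZ linearD /= trH -conj_mx_tr trH conj_mxK addrC.
pose u := toCmx v *m X.
have u0 : u != 0.
  apply: contra v0 => /eqP; rewrite /u -[v]hsubmxK toCmx_row.
  rewrite mul_row_col mulmx1 => eu.
  (* The imaginary part of [v X = 0] is [lsubmx v *m Y = 0]. *)
  have v1 : lsubmx v = 0.
    suff: lsubmx v *m Y = 0 by move/(congr1 (mulmx^~ (invmx Y))); rewrite mulmxK // mul0mx.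
    have : ImM (toCmx (lsubmx v) *m Z + toCmx (rsubmx v)) = 0.
      by rewrite eu; apply/matrixP => i j; rewrite !mxE.
    move=> <-; rewrite (ReImM Z) mulmxDr -scalemxAr -!toCmxM addrAC -toCmxD.
    by rewrite ImM_ReIm.
  move: eu; rewrite v1 toCmx0 mul0mx add0r -(toCmx0 1 p) => /toCmx_inj ->.
  by rewrite row_mx0.
have := herm_pos pYi u0.
have -> : u *m toCmx (invmx Y) *m (conj_mx u)^T = toCmx v *m H *m (toCmx v)^T.
  by rewrite /u /H conj_mxM conj_mx_toC trmx_mul !mulmxA.
set z := _ 0 0 => z0; suff -> : (v *m Defs.ReM H *m v^T) 0 0 = complex.Re z.
  by move: z0; rewrite ltcE => /andP[].
apply: complexI.
have -> : real_complex R ((v *m Defs.ReM H *m v^T) 0 0) = toCmx (v *m Defs.ReM H *m v^T) 0 0.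
  by rewrite [RHS]mxE.
rewrite !toCmxM reH ReJ_add toCmx_tr -scalemxAr -scalemxAl mxZE mulrC; congr (_ * _).
rewrite mulmxDr mulmxDl mxDE; congr (_ + _).
have -> : conjc z = conj_mx (toCmx v *m H *m (toCmx v)^T) 0 0 by rewrite [RHS]mxE.
by rewrite 2!conj_mxM conj_mx_tr conj_mx_toC.
Qed.

End SiegelSpace.

(** * Coordinates adapted to the boundary line *)

Section BoundaryFrame.
Variables (R : realType) (k : nat).
Local Notation n := (k + 1)%N.
Local Notation J := (Jmx R n).

(* The splitting of R^(2n) into the hyperbolic plane spanned by [e] (the line of F_k) and its
   dual vector [f], and the symplectic R^(2k) embedded by [incl]. *)
Definition incl : 'M[R]_(n + n, k + k) :=
  block_mx (col_mx 1%:M 0) 0 0 (col_mx 1%:M 0).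

Definition evec : 'cV[R]_(n + n) := col_mx (col_mx 0 1%:M) 0.

Definition fvec : 'cV[R]_(n + n) := col_mx 0 (col_mx 0 1%:M).

Local Notation e := evec.
Local Notation f := fvec.

Local Notation simp := (mul0mx, mulmx0, addr0, add0r, mulmx1, mul1mx, mulmxN, mulNmx, opprK, oppr0,
  trmx0, trmx1) (only parsing).

Lemma inclTincl : incl^T *m incl = 1%:M.
Proof.
rewrite /incl tr_block_mx !tr_col_mx !trmx0 !trmx1 mulmx_block !mul_row_col !simp.
by rewrite -scalar_mx_block.
Qed.

Lemma inclTe : incl^T *m e = 0.
Proof. by rewrite /incl /e tr_block_mx mul_block_col !tr_col_mx !mul_row_col !simp col_mx0. Qed.

Lemma inclTf : incl^T *m f = 0.
Proof. by rewrite /incl /f tr_block_mx mul_block_col !tr_col_mx !mul_row_col !simp col_mx0. Qed.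

Lemma eTe : e^T *m e = 1%:M.
Proof. by rewrite /e !tr_col_mx !mul_row_col !simp. Qed.

Lemma fTf : f^T *m f = 1%:M.
Proof. by rewrite /f !tr_col_mx !mul_row_col !simp. Qed.

Lemma eTf : e^T *m f = 0.
Proof. by rewrite /f /e !tr_col_mx !mul_row_col !simp. Qed.

Lemma fTe : f^T *m e = 0.
Proof. by rewrite -[e]trmxK -trmx_mul eTf trmx0. Qed.

Lemma eTincl : e^T *m incl = 0.
Proof. by rewrite -[incl]trmxK -trmx_mul inclTe trmx0. Qed.

Lemma fTincl : f^T *m incl = 0.
Proof. by rewrite -[incl]trmxK -trmx_mul inclTf trmx0. Qed.

(** Inserted between two factors, this identity performs the block computations below without
    coordinates. *)
Lemma frame_resolution : incl *m incl^T + e *m e^T + f *m f^T = 1%:M.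
Proof.
rewrite /incl /e /f tr_block_mx !tr_col_mx !trmx0 !trmx1 mulmx_block !mul_col_row !simp.
rewrite !add_block_mx !simp (scalar_mx_block _ _ 1).
rewrite (scalar_mx_block k 1 1); congr (block_mx _ _ _ _).
by rewrite add_block_mx !simp.
Qed.

Lemma Je : J *m e = - f.
Proof. by rewrite /Jmx /e /f mul_block_col !simp !opp_col_mx !simp. Qed.

Lemma Jf : J *m f = e.
Proof. by rewrite /Jmx /e /f mul_block_col !simp. Qed.

Lemma Jincl : J *m incl = incl *m Jmx R k.
Proof. by rewrite /Jmx /incl !mulmx_block !simp. Qed.

Lemma tr_Jmx p : (Jmx R p)^T = - Jmx R p.
Proof. by rewrite /Jmx tr_block_mx !opp_block_mx linearN /= !simp. Qed.

Lemma eTJ : e^T *m J = f^T.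
Proof. by rewrite -[J]opprK -tr_Jmx mulmxN -trmx_mul Je linearN opprK. Qed.

Lemma inclTJ : incl^T *m J = Jmx R k *m incl^T.
Proof. by rewrite -[J]opprK -tr_Jmx mulmxN -trmx_mul Jincl trmx_mul tr_Jmx mulNmx opprK. Qed.

Lemma De : Dmx R n *m e = e.
Proof. by rewrite /Dmx /e mul_block_col !simp. Qed.

Lemma Dincl : Dmx R n *m incl = incl *m Dmx R k.
Proof. by rewrite /Dmx /incl !mulmx_block !simp. Qed.

Lemma inclTD : incl^T *m Dmx R n = Dmx R k *m incl^T.
Proof. by rewrite -tr_Dmx -trmx_mul Dincl trmx_mul tr_Dmx. Qed.

Lemma Jmx_split : incl *m Jmx R k *m incl^T = J - e *m f^T + f *m e^T.
Proof.
rewrite -Jincl -mulmxA -{2}[J]mulmx1 -frame_resolution !mulmxDr.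
by rewrite !(mulmxA J) Je Jf mulNmx; apply/matrixP => i j; rewrite !mx_linE; ring.
Qed.

Lemma leviE (h : 'M[R]_(n + n)) : levi h = incl^T *m h *m incl.
Proof.
rewrite -[in RHS](submxK h) -[in RHS](submxK (ulsubmx h)) -[in RHS](submxK (ursubmx h)).
rewrite -[in RHS](submxK (dlsubmx h)) -[in RHS](submxK (drsubmx h)) /incl /levi.
by rewrite tr_block_mx !tr_col_mx !mulmx_block !simp !mul_row_block !mul_row_col !simp.
Qed.

Lemma evecE : e = delta_mx (e_last k) 0.
Proof.
have -> : e_last k = lshift n (rshift k ord0) by apply: val_inj; rewrite /= addn0.
apply/matrixP => i j; rewrite !ord1 /e [RHS]mxE andbT.
case: (split_ordP i) => i1 ->; last by rewrite col_mxEd mxE eq_rlshift.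
rewrite col_mxEu eq_lshift; case: (split_ordP i1) => i2 ->.
  by rewrite col_mxEu mxE eq_lrshift.
by rewrite col_mxEd !ord1 mxE !eqxx.
Qed.

Lemma stabFP (h : 'M[R]_(n + n)) : stabF h <-> exists l : R, h *m e = l *: e.
Proof.
rewrite evecE; split=> [sh|[l] eh i ni].
  exists (h (e_last k) (e_last k)); rewrite -colE; apply/matrixP => i j.
  rewrite !ord1 !mxE eqxx andbT; have [->|ni] := eqVneq i (e_last k); first by rewrite mulr1.
  by rewrite (sh _ ni) /= mulr0.
move/matrixP: eh => /(_ i 0); rewrite -colE !mxE (negPf ni) => ->.
by rewrite /= mulr0.
Qed.

(** * Maps preserving the boundary line *)

Section BlockTriangular.
Variables (P Q : 'M[R]_(n + n)) (a b : R).
Hypothesis Pe : P *m e = a *: e.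
Hypothesis fQ : f^T *m Q = b *: f^T.

(** In the inserted resolution of the identity, the term through [e] dies because [P] keeps the line
    of [e], and the term through [f] because [Q] keeps the covector [f^T]. *)
Lemma levi_mul : incl^T *m (P *m Q) *m incl = (incl^T *m P *m incl) *m (incl^T *m Q *m incl).
Proof.
rewrite !mulmxA -[in LHS](mulmx1 (_ *m P)) -frame_resolution !mulmxDr !mulmxDl.
rewrite !mulmxA -[_ *m P *m e]mulmxA Pe -scalemxAr inclTe scaler0 !mul0mx addr0.
rewrite -[_ *m f *m f^T *m Q]mulmxA -[_ *m (f^T *m Q) *m _]mulmxA fQ -scalemxAl fTincl.
by rewrite scaler0 mulmx0 addr0.
Qed.

End BlockTriangular.

(** Since [f^T = e^T J], the antisymplectic relation turns the eigenvector [e] into a left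
    eigenvector with eigenvalue [- a^-1], which equals [- a]. *)
Lemma fT_antisymplectic (P : 'M[R]_(n + n)) (a : R) :
  antisymplectic P -> P *m e = a *: e -> a ^+ 2 = 1 -> f^T *m P = - a *: f^T.
Proof.
move=> aP Pe a1; have : e^T *m (P^T *m J *m P) = - f^T by rewrite aP mulmxN eTJ.
rewrite !mulmxA -trmx_mul Pe linearZ /= -!scalemxAl eTJ => /(congr1 ( *:%R a)).
by rewrite scalerA -expr2 a1 scale1r scalerN scaleNr.
Qed.

(** The embedded form of [Jmx R k] differs from [J] only by terms containing [f], and these vanish
    against [P incl]. *)
Lemma levi_antisymplectic (P : 'M[R]_(n + n)) (b : R) :
  antisymplectic P -> f^T *m P = b *: f^T -> antisymplectic (incl^T *m P *m incl).
Proof.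
move=> aP fP; have fPi : f^T *m P *m incl = 0 by rewrite fP -scalemxAl fTincl scaler0.
rewrite /antisymplectic.
have -> : (incl^T *m P *m incl)^T *m Jmx R k *m (incl^T *m P *m incl) =
    incl^T *m P^T *m (incl *m Jmx R k *m incl^T) *m (P *m incl).
  by rewrite !trmx_mul trmxK !mulmxA.
have Pif : incl^T *m P^T *m f = 0.
  by rewrite -[f]trmxK -!trmx_mul mulmxA fPi trmx0.
rewrite Jmx_split mulmxDr mulmxBr mulmxDl mulmxBl.
rewrite [X in _ - X](_ : _ = 0) ?[X in _ + X](_ : _ = 0).
- rewrite subr0 addr0 -!mulmxA (mulmxA J) (mulmxA P^T) (mulmxA P^T J) aP mulNmx mulmxN.
  by rewrite mulmxA inclTJ -mulmxA inclTincl mulmx1.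
- by rewrite (mulmxA _ f) Pif !mul0mx.
- by rewrite -!mulmxA (mulmxA f^T) fPi !mulmx0.
Qed.

(** Between two factors [K] only the middle term of the resolution survives. Powers therefore pass
    through the middle block, at the cost of two outer factors. *)
Lemma corner_expr (K : 'M[R]_(n + n)) j : K *m e = 0 -> f^T *m K = 0 ->
  K ^+ j.+2 = K *m incl *m (incl^T *m K *m incl) ^+ j *m (incl^T *m K).
Proof.
move=> Ke fK.
have KK (A : 'M[R]_(n + n)) : f^T *m A = 0 -> K *m A = K *m incl *m (incl^T *m A).
  move=> fA; rewrite -{1}[A]mul1mx -frame_resolution !mulmxDl !mulmxDr !mulmxA Ke !mul0mx addr0.
  by rewrite -[_ *m f^T *m A]mulmxA fA mulmx0 addr0.
elim: j => [|j IH]; first by rewrite expr0 mulmx1 expr2 -mulmxE KK.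
rewrite exprS -mulmxE KK; last by rewrite exprS -mulmxE mulmxA fK mul0mx.
by rewrite IH exprS -mulmxE !mulmxA.
Qed.

Lemma corner_square (P : 'M[R]_(n + n)) (a : R) :
  P *m e = a *: e -> f^T *m P = - a *: f^T -> a ^+ 2 = 1 ->
  let K := P *m P - 1%:M in K *m e = 0 /\ f^T *m K = 0.
Proof.
move=> Pe fP a1; split.
  by rewrite mulmxBl mul1mx -mulmxA Pe -scalemxAr Pe scalerA -expr2 a1 scale1r subrr.
by rewrite mulmxBr mulmx1 mulmxA fP -scalemxAl fP scalerA mulrNN -expr2 a1 scale1r subrr.
Qed.

(** * Splitting off a hyperbolic plane *)

Lemma frame_ext p (A B : 'M[R]_(p, n + n)) :
  A *m incl = B *m incl -> A *m e = B *m e -> A *m f = B *m f -> A = B.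
Proof.
move=> Ai Ae Af; rewrite -[A]mulmx1 -[B]mulmx1 -frame_resolution !mulmxDr !mulmxA.
by rewrite Ai Ae Af.
Qed.

(* The unipotent symplectic map that fixes [e] and sends [f] to [f']. *)
Definition heis (f' : 'cV[R]_(n + n)) : 'M[R]_(n + n) :=
  e *m e^T + f' *m f^T + (incl + e *m (f'^T *m J *m incl)) *m incl^T.

Lemma heis_e f' : heis f' *m e = e.
Proof. by rewrite /heis !mulmxDl -!mulmxA eTe fTe inclTe !mulmx0 mulmx1 !addr0. Qed.

Lemma heis_f f' : heis f' *m f = f'.
Proof. by rewrite /heis !mulmxDl -!mulmxA eTf fTf inclTf !mulmx0 mulmx1 !addr0 add0r. Qed.

Lemma heis_incl f' : heis f' *m incl = incl + e *m (f'^T *m J *m incl).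
Proof. by rewrite /heis !mulmxDl -!mulmxA eTincl fTincl inclTincl !mulmx0 !mulmx1 !add0r. Qed.

(** The pairing of [e] with [f'] is [1] by hypothesis, and the summand [e (f'^T J incl)] makes the
    image of the embedded space orthogonal to [f']. *)
Lemma heis_symplectic f' : f^T *m f' = 1%:M -> symplectic (heis f').
Proof.
move=> ff'; have f'f : f'^T *m f = 1%:M by rewrite -[f]trmxK -trmx_mul ff' trmx1.
have fnu : f^T *m heis f' = f^T.
  apply: frame_ext; rewrite -mulmxA ?heis_e ?heis_f ?heis_incl //; last by rewrite ff' fTf.
  by rewrite mulmxDr mulmxA fTe mul0mx addr0.
have nuf : (heis f')^T *m f = f by rewrite -[f]trmxK -trmx_mul fnu.
have f'Je : f'^T *m J *m e = - 1%:M by rewrite -mulmxA Je mulmxN f'f.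
have f'Jf' : f'^T *m J *m f' = 0.
  have : (f'^T *m J *m f')^T = - (f'^T *m J *m f').
    by rewrite !trmx_mul trmxK tr_Jmx mulNmx mulmxN mulmxA.
  move/matrixP => /(_ 0 0); rewrite mxE mxNE => eq0.
  by apply/matrixP => i j; rewrite !ord1 [RHS]mxE; lra.
have f'Jnu : f'^T *m J *m heis f' = - e^T.
  apply: frame_ext; rewrite -mulmxA ?heis_e ?heis_f ?heis_incl //.
  - by rewrite mulmxDr (mulmxA _ e) f'Je mulNmx mul1mx subrr mulNmx eTincl oppr0.
  - by rewrite f'Je mulNmx eTe.
  - by rewrite f'Jf' mulNmx eTf oppr0.
have inclnu : incl^T *m heis f' = incl^T + incl^T *m f' *m f^T.
  apply: frame_ext; rewrite -mulmxA ?heis_e ?heis_f ?heis_incl //.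
  - by rewrite mulmxDr mulmxDl (mulmxA _ e) inclTe mul0mx inclTincl -!mulmxA fTincl !mulmx0.
  - by rewrite mulmxDl -!mulmxA fTe !mulmx0 addr0.
  - by rewrite mulmxDl -!mulmxA fTf inclTf mulmx1 add0r.
apply: frame_ext; rewrite -mulmxA ?heis_e ?heis_f ?heis_incl.
- have nui : (heis f')^T *m incl = incl + f *m (f'^T *m incl).
    by rewrite -[incl]trmxK -trmx_mul inclnu linearD /= !trmx_mul !trmxK.
  rewrite mulmxDr (mulmxA _ e) -(mulmxA _ J e) Je mulmxN nuf mulNmx -(mulmxA _ J incl) Jincl.
  by rewrite mulmxA nui mulmxDl -(mulmxA f'^T J) Jincl -!mulmxA addrK.
- by rewrite -mulmxA Je mulmxN nuf.
- rewrite Jf; move/(congr1 trmx): f'Jnu; rewrite !trmx_mul tr_Jmx trmxK [in RHS]linearN /= trmxK.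
  by rewrite mulNmx mulmxN => /oppr_inj; rewrite mulmxA.
Qed.

Definition levi_sum (P1 : 'M[R]_(k + k)) (a : R) : 'M[R]_(n + n) :=
  incl *m P1 *m incl^T + a *: (e *m e^T - f *m f^T).

Lemma levi_sum_incl P1 a : levi_sum P1 a *m incl = incl *m P1.
Proof.
rewrite mulmxDl -scalemxAl mulmxBl -!mulmxA inclTincl eTincl fTincl !mulmx0 subrr scaler0.
by rewrite addr0 mulmx1.
Qed.

Lemma levi_sum_e P1 a : levi_sum P1 a *m e = a *: e.
Proof.
rewrite mulmxDl -scalemxAl mulmxBl -!mulmxA inclTe eTe fTe !mulmx0 subr0 mulmx1.
by rewrite add0r.
Qed.

Lemma levi_sum_f P1 a : levi_sum P1 a *m f = - a *: f.
Proof.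
rewrite mulmxDl -scalemxAl mulmxBl -!mulmxA inclTf eTf fTf !mulmx0 sub0r mulmx1.
by rewrite add0r scalerN scaleNr.
Qed.

(** As [f'] is an eigenvector, [f'^T J] is a left eigenvector of [P], and so is [f^T = e^T J]. Hence
    [P] preserves the symplectic complement of the plane of [e] and [f'], which is the image of the
    embedded space under [heis f']. *)
Lemma heis_split (P : 'M[R]_(n + n)) (a : R) (f' : 'cV[R]_(n + n)) :
  antisymplectic P -> P *m e = a *: e -> f^T *m P = - a *: f^T ->
  f^T *m f' = 1%:M -> P *m f' = - a *: f' -> a ^+ 2 = 1 ->
  P *m heis f' = heis f' *m levi_sum (incl^T *m P *m incl) a.
Proof.
move=> aP Pe fP ff' Pf' a1; have f'f : f'^T *m f = 1%:M by rewrite -[f]trmxK -trmx_mul ff' trmx1.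
have f'Je : f'^T *m J *m e = - 1%:M by rewrite -mulmxA Je mulmxN f'f.
have Pi : P *m incl = incl *m (incl^T *m P *m incl) + e *m (e^T *m P *m incl).
  rewrite -{1}[P]mul1mx -frame_resolution !mulmxDl -!mulmxA (mulmxA f^T) fP -scalemxAl fTincl.
  by rewrite scaler0 mulmx0 addr0.
have f'JP : f'^T *m J *m P = a *: (f'^T *m J).
  have : (P *m f')^T *m J *m P = - (f'^T *m J) by rewrite trmx_mul -!mulmxA (mulmxA P^T) aP mulmxN.
  rewrite Pf' linearZ /= -!scalemxAl => /(congr1 ( *:%R (- a))).
  by rewrite scalerA mulrNN -expr2 a1 scale1r scalerN scaleNr opprK.
set P1 := incl^T *m P *m incl in Pi *; set r := e^T *m P *m incl in Pi.
clearbody P1 r.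
apply: frame_ext; rewrite -[LHS]mulmxA -[RHS]mulmxA.
- rewrite levi_sum_incl (mulmxA _ incl P1) !heis_incl mulmxDr mulmxDl mulmxA Pe Pi -addrA.
  congr (_ + _); rewrite -scalemxAl scalemxAr -mulmxDr -[RHS]mulmxA; congr (_ *m _).
  have -> : f'^T *m J *m incl *m P1 = f'^T *m J *m (P *m incl) - f'^T *m J *m e *m r.
    by rewrite Pi mulmxDr !mulmxA addrK.
  by rewrite mulmxA f'JP f'Je -scalemxAl mulNmx mul1mx opprK addrC.
- by rewrite levi_sum_e heis_e -scalemxAr heis_e.
- by rewrite levi_sum_f heis_f -scalemxAr heis_f.
Qed.

(** * Points of the Siegel space over the boundary component *)

Local Notation C := (complex R).
Local Notation ImM := (@Defs.ImM R _ _).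

Lemma ImM_toCMl p q r (A : 'M[R]_(p, q)) (M : 'M[C]_(q, r)) : ImM (toCmx A *m M) = A *m ImM M.
Proof. by rewrite {1}(ReImM M) mulmxDr -scalemxAr -!toCmxM ImM_ReIm. Qed.

Lemma ImM_toCMr p q r (M : 'M[C]_(p, q)) (A : 'M[R]_(q, r)) : ImM (M *m toCmx A) = ImM M *m A.
Proof. by rewrite {1}(ReImM M) mulmxDl -scalemxAl -!toCmxM ImM_ReIm. Qed.

Lemma ImM_toC p q (A : 'M[R]_(p, q)) : ImM (toCmx A) = 0.
Proof. by apply/matrixP => i j; rewrite !mxE. Qed.

Lemma ImMD p q (A B : 'M[C]_(p, q)) : ImM (A + B) = ImM A + ImM B.
Proof. by apply/matrixP => i j; rewrite !mxE; case: (A i j) (B i j) => ? ? [? ?]. Qed.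

Lemma ImMN p q (A : 'M[C]_(p, q)) : ImM (- A) = - ImM A.
Proof. by apply/matrixP => i j; rewrite !mxE; case: (A i j). Qed.

Definition cusp_point (Z : 'M[C]_k) (y : R) : 'M[C]_n := block_mx Z 0 0 (Complex 0 y)%:M.

Lemma cusp_point_in_h Z y : in_h Z -> 0 < y -> in_h (cusp_point Z y).
Proof.
move=> [symZ [symY posY]] y0; split; first by rewrite tr_block_mx symZ !trmx0 tr_scalar_mx.
have -> : ImM (cusp_point Z y) = block_mx (ImM Z) 0 0 y%:M.
  rewrite /Defs.ImM map_block_mx; congr (block_mx _ _ _ _); apply/matrixP => i j; rewrite !mxE //.
  by rewrite !ord1.
split=> [|v v0]; first by rewrite tr_block_mx symY !trmx0 tr_scalar_mx.
rewrite -[v]hsubmxK mul_row_block !mulmx0 addr0 add0r tr_row_mx mul_row_col mxDE.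
have sq : (rsubmx v *m y%:M *m (rsubmx v)^T) 0 0 = y * (rsubmx v 0 0) ^+ 2.
  by rewrite mul_mx_scalar -scalemxAl mxZE !mxE big_ord1 !mxE expr2.
rewrite sq; have [l0|l0] := eqVneq (lsubmx v) 0; last first.
  by rewrite ltr_pwDl ?posY // mulr_ge0 ?sqr_ge0 // ltW.
rewrite l0 !mul0mx mxE add0r mulr_gt0 // lt_def sqr_ge0 sqrf_eq0 andbT.
apply: contra v0 => /eqP r0; rewrite -[v]hsubmxK l0.
by rewrite (_ : rsubmx v = 0) ?row_mx0 //; apply/matrixP => i j; rewrite !ord1 r0 mxE.
Qed.

Lemma cusp_point_frame Z y : frame (cusp_point Z y) =
  row_mx (toCmx incl *m frame Z) (Complex 0 y *: toCmx e + toCmx f).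
Proof.
rewrite /frame /cusp_point /incl /evec /fvec toCmx_block !toCmx_col !toCmx0 !toCmx1 mul_block_col.
rewrite !mul_col_mx !simp scale_col_mx add_col_mx !scaler0 !simp scale_col_mx scaler0.
by rewrite -block_mxEh [RHS]block_mxEv -!block_mxEh -scalar_mx_block scalemx1.
Qed.

(** On the hyperbolic plane [i y e + f] goes to [a (i y e - f)], which is [- a] times its conjugate,
    whatever [y] is. *)
Lemma cusp_point_fixed (P1 : 'M[R]_(k + k)) (a : R) Z y : fixes_frame P1 Z ->
  fixes_frame (levi_sum P1 a) (cusp_point Z y).
Proof.
move=> [Q eQ]; exists (block_mx Q 0 0 (Complex (- a) 0)%:M).
rewrite cusp_point_frame mul_mx_row mulmxA -toCmxM levi_sum_incl toCmxM -mulmxA eQ.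
rewrite mulmxDr -scalemxAr -!toCmxM levi_sum_e levi_sum_f !toCmxZ.
have -> : conj_mx (row_mx (toCmx incl *m frame Z) (Complex 0 y *: toCmx e + toCmx f)) =
    row_mx (toCmx incl *m conj_mx (frame Z)) (Complex 0 (- y) *: toCmx e + toCmx f).
  by rewrite conj_mx_row conj_mxM conj_mxD conj_mxZ !conj_mx_toC.
rewrite mul_row_block !mulmx0 addr0 add0r mulmxA mul_mx_scalar scalerDr !scalerA.
congr (row_mx _ (_ *: _ + _)).
by apply/eqP; rewrite eq_complex /=; apply/andP; split; apply/eqP; ring.
Qed.

Lemma heis_cusp_point f' Z y : f^T *m f' = 1%:M -> in_h Z -> 0 < y ->
  ulsubmx (sp_act (heis f') (cusp_point Z y)) = Z /\ height (sp_act (heis f') (cusp_point Z y)) = y.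
Proof.
move=> ff' hZ y0; pose x1 := usubmx (usubmx f'); pose c := dsubmx (usubmx f').
pose x2 := usubmx (dsubmx f').
have ef' : f' = col_mx (col_mx x1 c) (col_mx x2 1%:M).
  rewrite -[LHS]vsubmxK -[usubmx f']vsubmxK -[dsubmx f']vsubmxK -/x1 -/c -/x2.
  congr (col_mx _ (col_mx _ _)); rewrite -ff' -[f' in RHS]vsubmxK -[dsubmx f' in RHS]vsubmxK /fvec.
  by rewrite !tr_col_mx !mul_row_col !simp.
have erho : f'^T *m J *m incl = row_mx (- x2^T) x1^T.
  rewrite -mulmxA Jincl mulmxA ef' /incl !tr_col_mx mul_row_block !mul_row_col !simp.
  by rewrite !mul_mx_row !simp add_row_mx !simp.
(* These blocks result from dividing the transformed frame by its lower block, the unipotent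
   [block_mx 1 x2 0 1]. *)
pose w := toCmx x1 - Z *m toCmx x2.
pose w' := toCmx x1^T - toCmx x2^T *m Z.
pose z := (Complex 0 y)%:M + toCmx c - w' *m toCmx x2.
have eZ : sp_act (heis f') (cusp_point Z y) = block_mx Z w w' z.
  apply: (@sp_act_frameP _ _ _ _ _ (block_mx 1%:M (toCmx x2) 0 1%:M)).
  - exact: heis_symplectic.
  - exact: cusp_point_in_h.
  rewrite cusp_point_frame mul_mx_row mulmxDr -scalemxAr mulmxA -!toCmxM heis_incl heis_e heis_f.
  rewrite erho toCmxD toCmxM mulmxDl -mulmxA toCmx_row toCmxN.
  rewrite [row_mx _ _ *m _]mul_row_col mulmx1.
  rewrite /incl /evec ef' toCmx_block !toCmx_col !toCmx0 !toCmx1 /frame mul_block_col.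
  rewrite !mul_col_mx !simp scale_col_mx !add_col_mx !scaler0 !simp.
  rewrite scale_col_mx scaler0 !add_col_mx !simp.
  rewrite -block_mxEh [LHS]block_mxEv -!block_mxEh !mul_row_block !simp -block_mxEv.
  congr (col_mx (block_mx _ _ _ _) _).
  - by rewrite /w addrC subrK.
  - by rewrite /w' addrC.
  - by rewrite /z [RHS]addrC subrK scalemx1.
rewrite eZ block_mxKul; split=> //; rewrite /height.
have -> : Defs.ImM (block_mx Z w w' z) = block_mx (ImM Z) (ImM w) (ImM w') (ImM z).
  exact: map_block_mx.
rewrite block_mxKul block_mxKur block_mxKdl block_mxKdr.
have [_ pY] := hZ; have uY := posdef_unit pY.
have -> : ImM w = - (ImM Z *m x2) by rewrite /w ImMD ImMN ImM_toC ImM_toCMr add0r.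
have ew' : ImM w' = - (x2^T *m ImM Z) by rewrite /w' ImMD ImMN ImM_toC ImM_toCMl add0r.
(* The extra term of this corner is exactly what the Schur complement in [height] subtracts. *)
have -> : ImM z = y%:M + x2^T *m ImM Z *m x2.
  rewrite /z !ImMD ImMN ImM_toC ImM_toCMr ew' mulNmx opprK addr0; congr (_ + _).
  by apply/matrixP => i j; rewrite !ord1 !mxE.
rewrite ew' !mulNmx mulmxN opprK mulmxK // mulmxA addrK.
by rewrite mxE eqxx.
Qed.

Lemma antisymplectic_involution_fixed (P : 'M[R]_(n + n)) (a : R) (Z0 : 'M[C]_k) (t : R) :
  antisymplectic P -> P *m P = 1%:M -> P *m e = a *: e -> a ^+ 2 = 1 ->
  in_h Z0 -> fixes_frame (incl^T *m P *m incl) Z0 ->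
  exists Z, [/\ in_h Z, ulsubmx Z = Z0, t < height Z & fixes_frame P Z].
Proof.
move=> aP PP Pe a1 hZ fixZ; have fP := fT_antisymplectic aP Pe a1.
(* This is the projection of [f] to the eigenspace of [P] for [- a]; the left eigenvector [f^T]
   keeps its pairing with [e] equal to [1]. *)
pose f' := 2^-1 *: (f - a *: (P *m f)).
have ff' : f^T *m f' = 1%:M.
  rewrite /f' -scalemxAr mulmxBr -scalemxAr mulmxA fP -scalemxAl fTf scalerA mulrN -expr2 a1.
  by rewrite scaleN1r opprK -mulr2n -scaler_nat scalerA mulVf ?scale1r // pnatr_eq0.
have Pf' : P *m f' = - a *: f'.
  rewrite /f' -scalemxAr mulmxBr -scalemxAr mulmxA PP mul1mx scalerA mulrC -scalerA; congr (_ *: _).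
  by rewrite scalerBr scalerA !mulNr -expr2 a1 !scaleNr scale1r opprK addrC.
have y0 : 0 < `|t| + 1 by rewrite ltr_wpDl.
have sn := heis_symplectic ff'; have hW := cusp_point_in_h hZ y0.
have [ulZ htZ] := heis_cusp_point ff' hZ y0.
exists (sp_act (heis f') (cusp_point Z0 (`|t| + 1))); split=> //.
- exact: sp_act_in_h.
- by rewrite htZ ltr_pwDr // ler_norm.
apply: fixes_frame_act (cusp_point_fixed a _ fixZ) => //; exact: heis_split.
Qed.

End BoundaryFrame.

(** * Consequences of integrality *)

Section Arithmetic.
Variable R : realType.
Local Notation intmx := (mxOver (@Num.int R)).

Lemma intmxD p q (A B : 'M[R]_(p, q)) : A \is a intmx -> B \is a intmx -> A + B \is a intmx.
Proof.
by move=> /mxOverP iA /mxOverP iB; apply/mxOverP => i j; rewrite mxDE rpredD.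
Qed.

Lemma intmxZ p q (a : R) (A : 'M[R]_(p, q)) :
  a \is a Num.int -> A \is a intmx -> a *: A \is a intmx.
Proof. by move=> ia /mxOverP iA; apply/mxOverP => i j; rewrite mxZE rpredM. Qed.

(** Infinite descent: if [a] had absolute value below [1], multiplication by [a], which acts as [T],
    would keep integral eigenvectors integral while strictly shrinking every nonzero entry. *)
Lemma int_eigenvector_ge1 p (T : 'M[R]_p) (v : 'cV[R]_p) (a : R) :
  T \is a intmx -> v \is a intmx -> v != 0 -> a != 0 -> T *m v = a *: v -> 1 <= `|a|.
Proof.
move=> iT iv v0 a0 Tv; rewrite leNgt; apply/negP => a1.
have desc (b : nat) : forall u : 'cV[R]_p, u \is a intmx -> T *m u = a *: u ->
    forall i, `|u i 0| < b%:R -> u i 0 = 0.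
  elim: b => [|b IH] u iu Tu i; first by rewrite ltNge normr_ge0.
  have [//|ui0] := eqVneq (u i 0) 0; have ui : 0 < `|u i 0| by rewrite normr_gt0.
  move=> ub; have iau : a *: u \is a intmx by rewrite -Tu mxOverM.
  have : (a *: u) i 0 = 0.
    apply: IH => //; first by rewrite -scalemxAr Tu.
    have /natrP[q uq] : `|u i 0| \is a Num.nat by rewrite natr_norm_int // (mxOverP iu).
    rewrite mxZE normrM; apply: lt_le_trans (_ : `|u i 0| <= _); first by rewrite gtr_pMl.
    by move: ub; rewrite uq ltr_nat ler_nat ltnS.
  by rewrite mxZE => /eqP; rewrite mulf_eq0 (negPf a0) => /eqP.
case/eqP: v0; apply/matrixP => i j; rewrite !ord1 [RHS]mxE.
have /natrP[q vq] : `|v i 0| \is a Num.nat by rewrite natr_norm_int // (mxOverP iv).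
by apply: (desc q.+1) => //; rewrite vq ltr_nat.
Qed.

Lemma rational_clear_denominators p (v : 'cV[R]_p) :
  (forall i, exists r : rat, v i 0 = ratr r) -> exists2 c : R, c != 0 & c *: v \is a intmx.
Proof.
move=> /fin_all_exists[r vr]; exists (\prod_i (denq (r i))%:~R).
  by apply/prodf_neq0 => i _; rewrite intr_eq0 denq_neq0.
apply/mxOverP => i j; rewrite !ord1 mxZE (bigD1 i) //= vr /ratr.
rewrite mulrAC mulrC mulrA.
set pr := \prod_(_ | _) _; have -> : pr * (denq (r i))%:~R * ((numq (r i))%:~R / (denq (r i))%:~R) =
  pr * (numq (r i))%:~R :> R by field; rewrite intr_eq0 denq_neq0.
by rewrite rpredM ?rpred_prod // => *; rewrite ?intr_int.
Qed.

(** By Cauchy-Schwarz the square of each entry of [N ^+ j.+2] is at most [2 ^- j] times a bound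
    independent of [j]. Once this is below [1], integrality forces the entry to vanish. *)
Lemma int_isometry_nilpotent p q (N : 'M[R]_p) (A : 'M[R]_(p, q)) (B : 'M[R]_(q, p))
    (G M : 'M[R]_q) (c : R) :
  N \is a intmx -> posdef G -> M *m G *m M^T = G -> 8 <= c ->
  (forall j, N ^+ j.+2 = A *m (c^-1 *: (M - 1%:M)) ^+ j *m B) -> exists j, N ^+ j.+2 = 0.
Proof.
move=> iN pG iso c8 eN; have uG := posdef_unit pG; have [symG _] := pG.
(* The factor [invmx G] turns the plain product with a column of [B] into a value of the form
   [G]. *)
pose s i' := (col i' B)^T *m invmx G.
pose bnd i i' := (row i A *m G *m (row i A)^T) 0 0 * (s i' *m G *m (s i')^T) 0 0.
have bnd0 i i' : 0 <= bnd i i' by rewrite mulr_ge0 ?posdef_ge0.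
(* Summing over all entries lets one exponent serve them all. *)
pose tot := \sum_i \sum_i' bnd i i'; pose j := (Num.truncn tot).+1.
have le_tot i i' : bnd i i' <= tot.
  rewrite /tot (bigD1 i) //= (bigD1 i') //= -addrA lerDl addr_ge0 ?sumr_ge0 // => i1 _.
  by rewrite sumr_ge0.
have tot_lt : tot < 2 ^+ j.
  apply: lt_trans (truncnS_gt tot) _; rewrite -natrX ltr_nat; exact: ltn_expl.
have iNj : N ^+ j.+2 \is a intmx.
  by elim: j.+2 => [|i IH]; [rewrite expr0 mxOver_scalar ?rpred1|rewrite exprS -mulmxE mxOverM].
exists j; apply/matrixP => i i'; rewrite [RHS]mxE; apply/eqP; apply: contraT => ne0.
have := sqr_intr_ge1 (mxOverP iNj i i') ne0; rewrite leNgt => /negP[].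
set W := c^-1 *: _ in eN.
have -> : (N ^+ j.+2) i i' = (row i A *m W ^+ j *m G *m (s i')^T) 0 0.
  rewrite /s trmx_mul trmxK trmx_inv symG mulmxA mulmxK // eN -row_mul [LHS]mxE [RHS]mxE.
  by apply: eq_bigr => l _; rewrite [row _ _ _ _]mxE [col _ _ _ _]mxE.
apply: le_lt_trans (form_cauchy_schwarz _ _ pG) _.
apply: le_lt_trans (_ : (2^-1) ^+ j * bnd i i' < 1).
  by rewrite mulrA ler_wpM2r ?posdef_ge0 // isometry_sub1_expr_le.
rewrite exprVn mulrC ltr_pdivrMr ?exprn_gt0 // mul1r; exact: le_lt_trans tot_lt.
Qed.

Lemma in_GammaP (m p : nat) (gam : 'M[R]_(p + p)) : in_Gamma m gam <->
  symplectic gam /\ exists2 M, M \is a intmx & gam = 1%:M + (4 * m)%:R *: M.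
Proof.
split=> [[sg cg]|[sg [M iM eg]]]; split=> //; last first.
  move=> i j; have /intrP[z Mz] := mxOverP iM i j; exists z.
  by rewrite eg mxDE addrC addKr mxZE Mz rmorphM.
have [z ez] := fin_all_exists (fun ij : 'I_(p + p) * 'I_(p + p) => cg ij.1 ij.2).
exists (\matrix_(i, j) (z (i, j))%:~R); first by apply/mxOverP => i j; rewrite mxE intr_int.
apply/matrixP => i j; rewrite mxDE mxZE [X in _ * X]mxE; have := ez (i, j).
by rewrite /= rmorphM /= => <-; rewrite addrC subrK.
Qed.

End Arithmetic.

(** * Symplectic matrices and the inverse square root *)

Section Symplectic.
Variables (R : realType) (p : nat).
Implicit Types (A B T U : 'M[R]_(p + p)).
Local Notation J := (Jmx R p).
Local Notation intmx := (mxOver (@Num.int R)).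

Lemma JmxK : J *m J = - 1%:M.
Proof.
rewrite /Jmx mulmx_block !(mul0mx, mulmx0, addr0, add0r, mulmx1, mul1mx).
by rewrite (scalar_mx_block p p 1) opp_block_mx !oppr0.
Qed.

Lemma symplectic_mulVmx A : symplectic A -> (- J *m A^T *m J) *m A = 1%:M.
Proof. by move=> sA; rewrite -!mulmxA (mulmxA A^T) sA mulNmx JmxK opprK. Qed.

Lemma symplectic_unit A : symplectic A -> A \in unitmx.
Proof. by move/symplectic_mulVmx/mulmx1_unit => []. Qed.

Lemma formM A B (X : 'M[R]_(p + p)) : (A *m B)^T *m X *m (A *m B) = B^T *m (A^T *m X *m A) *m B.
Proof. by rewrite trmx_mul !mulmxA. Qed.

Lemma symplectic_inv A : symplectic A -> symplectic (invmx A).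
Proof.
move=> sA; have uA := symplectic_unit sA.
by rewrite /symplectic -{1}sA -formM mulmxV // trmx1 mul1mx mulmx1.
Qed.

Lemma symplecticM A B : symplectic A -> symplectic B -> symplectic (A *m B).
Proof. by move=> sA sB; rewrite /symplectic formM sA sB. Qed.

Lemma antisymplecticMr A B : antisymplectic A -> symplectic B -> antisymplectic (A *m B).
Proof. by move=> sA sB; rewrite /antisymplectic formM sA mulmxN mulNmx sB. Qed.

Lemma antisymplecticMl A B : symplectic A -> antisymplectic B -> antisymplectic (A *m B).
Proof. by move=> sA sB; rewrite /antisymplectic formM sA sB. Qed.

Lemma antisymplecticM A B : antisymplectic A -> antisymplectic B -> symplectic (A *m B).
Proof. by move=> sA sB; rewrite /symplectic formM sA mulmxN mulNmx sB opprK. Qed.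

Lemma Jmx_int : J \is a intmx.
Proof.
apply/mxOverP => i j; rewrite /Jmx !mxE.
by case: split => ?; rewrite !mxE; case: split => ?; rewrite !mxE ?rpredN ?rpred0 ?rpred_nat.
Qed.

Lemma Dmx_int : Dmx R p \is a intmx.
Proof.
apply/mxOverP => i j; rewrite /Dmx !mxE.
by case: split => ?; rewrite !mxE; case: split => ?; rewrite !mxE ?rpredN ?rpred0 ?rpred_nat.
Qed.

(* The truncated binomial series of [(1 + U)^(-1/2)], exact when [U^3 = 0]. *)
Definition inv_sqrt d (U : 'M[R]_d) : 'M[R]_d := 1%:M - 2^-1 *: U + (3 / 8) *: (U *m U).

Lemma inv_sqrt_square d (U : 'M[R]_d) : U *m U *m U = 0 ->
  (1%:M + U) *m (inv_sqrt U *m inv_sqrt U) = 1%:M.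
Proof.
move=> U3; rewrite /inv_sqrt.
have U3' : U *m (U *m U) = 0 by rewrite mulmxA.
have U4 : U *m U *m (U *m U) = 0 by rewrite mulmxA U3 mul0mx.
(* With [V] opaque, the rewrite rules reduce every monomial to [1], [U] or [V]. *)
set V := U *m U in U3 U3' U4 *; have UU : U *m U = V by [].
clearbody V.
do ! rewrite ?mulmxDl ?mulmxDr ?mulmxN ?mulNmx -?scalemxAl -?scalemxAr ?mulmx1 ?mul1mx ?UU ?U3 ?U3' ?U4
  ?scaler0 ?oppr0 ?addr0 ?mulmx0.
by apply/matrixP => i j; rewrite !mx_linE; field.
Qed.

(** Because [U] has cube zero, [1 - U + U ^+ 2] inverts [1 + U], so the adjoint of [U] for [J] is
    [U ^+ 2 - U]. The claim becomes a polynomial identity in [U]. *)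
Lemma inv_sqrt_symplectic U : symplectic (1%:M + U) -> U *m U *m U = 0 -> symplectic (inv_sqrt U).
Proof.
move=> sU U3.
have UJ : U^T *m J = J *m (U *m U - U).
  have : (1%:M + U)^T *m J = J *m (1%:M - U + U *m U).
    rewrite -{2}sU -mulmxA; have -> : (1%:M + U) *m (1%:M - U + U *m U) = 1%:M.
      rewrite !mulmxDl !mulmxDr !mul1mx !mulmx1 mulmxN mulmxA U3.
      by apply/matrixP => i j; rewrite !mx_linE [(0 : 'M_ _) _ _]mxE; ring.
    by rewrite mulmx1.
  have -> : (1%:M + U)^T = 1%:M + U^T by rewrite linearD /= trmx1.
  rewrite mulmxDl mul1mx -addrA [J *m (1%:M + _)]mulmxDr mulmx1 => /addrI ->.
  by rewrite addrC.
have U3' : U *m (U *m U) = 0 by rewrite mulmxA.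
have U4 : U *m U *m (U *m U) = 0 by rewrite mulmxA U3 mul0mx.
have UUJ : U^T *m U^T *m J = J *m (U *m U).
  have e : (U *m U - U) *m (U *m U - U) = U *m U.
    by rewrite mulmxBl !mulmxBr U3 U3' U4 !(subr0, sub0r, opprK).
  by rewrite -mulmxA UJ mulmxA UJ -mulmxA e.
rewrite /symplectic.
have -> : (inv_sqrt U)^T = 1%:M - 2^-1 *: U^T + (3 / 8) *: (U^T *m U^T).
  by rewrite /inv_sqrt linearD linearB /= !linearZ /= trmx_mul trmx1.
rewrite /inv_sqrt !mulmxDl mulNmx -!scalemxAl UUJ UJ mul1mx.
set V := U *m U in U3 U3' U4 *; have UU : U *m U = V by [].
clearbody V.
do ! rewrite ?mulmxDl ?mulmxDr ?mulmxN ?mulNmx -?scalemxAl -?scalemxAr ?mulmx1 ?mul1mx -?(mulmxA J)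
  ?UU ?U3 ?U3' ?U4 ?scaler0 ?oppr0 ?addr0 ?mulmx0.
by rewrite sub0r; apply/matrixP => i j; rewrite !mx_linE; field.
Qed.

Lemma inv_sqrt_intertwine d d' (U : 'M[R]_d) (K : 'M[R]_d') (g : 'M[R]_(d, d')) :
  U *m g = g *m K -> inv_sqrt U *m g = g *m inv_sqrt K.
Proof.
move=> Ug; rewrite /inv_sqrt !mulmxDl !mulmxDr mulNmx mulmxN -!scalemxAl -!scalemxAr mul1mx mulmx1.
by rewrite Ug -(mulmxA U) Ug !mulmxA Ug.
Qed.

(* Conjugation by [D] changes the sign of the off-diagonal blocks, so that modulo [8m] the
   product [tau(gam) gam] of two matrices congruent to [1] modulo [4m] loses its linear term. *)
Lemma Gamma_square (m : nat) (gam : 'M[R]_(p + p)) : in_Gamma m gam ->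
  exists2 N, N \is a intmx &
    (Dmx R p *m gam) *m (Dmx R p *m gam) = 1%:M + (8 * m)%:R *: N.
Proof.
case/in_GammaP => _ [M iM ->].
have iD := Dmx_int.
exists (block_mx (ulsubmx M) 0 0 (drsubmx M) + (2 * m)%:R *: (tau_g M *m M)).
  apply: intmxD; last by rewrite intmxZ ?rpred_nat // tau_gE !mxOverM.
  apply/mxOverP => i j; rewrite !mxE.
  by case: split => ?; rewrite !mxE; case: split => ?; rewrite !mxE ?rpred0 // (mxOverP iM).
set c := (4 * m)%:R; have -> : (8 * m)%:R = 2 * c by rewrite /c !natrM; ring.
have -> : (2 * m)%:R = 2^-1 * c :> R by rewrite /c !natrM; field.
have tM : tau_g M + M = 2 *: block_mx (ulsubmx M) 0 0 (drsubmx M).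
  rewrite -{2}(submxK M) /tau_g add_block_mx !addNr scale_block_mx !scaler0.
  by rewrite !scaler_nat !mulr2n.
have tg : Dmx R p *m (1%:M + c *: M) *m Dmx R p = 1%:M + c *: tau_g M.
  by rewrite mulmxDr mulmx1 mulmxDl DmxK -scalemxAr -scalemxAl tau_gE.
rewrite mulmxA tg !mulmxDl !mulmxDr !mulmx1 !mul1mx.
do ! rewrite -?scalemxAl -?scalemxAr.
move: (tau_g M *m M) => Y.
have -> : tau_g M = 2 *: block_mx (ulsubmx M) 0 0 (drsubmx M) - M by rewrite -tM addrK.
by apply/matrixP => i j; rewrite !mx_linE; field.
Qed.

End Symplectic.

(** * Correcting [gam] within the congruence subgroup *)

Section Correction.
Variable R : realType.
Local Notation intmx := (mxOver (@Num.int R)).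

(** With [U = 8m N], the terms [U / 2 = 4m N] and [3 U ^+ 2 / 8 = 4m (6m N ^+ 2)] are both divisible
    by [4m]; the congruence of [T ^+ 2] modulo [8m] absorbs the denominator of the linear term. *)
Lemma Gamma_inv_sqrt (m p : nat) (gam : 'M[R]_(p + p)) :
  let T := Dmx R p *m gam in let U := T *m T - 1%:M in
  in_Gamma m gam -> U *m U *m U = 0 -> in_Gamma m (gam *m inv_sqrt U).
Proof.
move=> T U Ggam U3; have [N iN TT] := Gamma_square Ggam.
have [sgam [M iM egam]] := (in_GammaP m gam).1 Ggam.
have aT : antisymplectic T by apply: antisymplecticMr (Dmx_anti R p) sgam.
have U1 : 1%:M + U = T *m T by rewrite addrC subrK.
apply/in_GammaP; split.
  by apply: symplecticM => //; apply: inv_sqrt_symplectic => //; rewrite U1; apply: antisymplecticM.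
set c : R := (4 * m)%:R in egam *.
have UN : U = (2 * c) *: N by rewrite /U TT addrC addKr /c !natrM; congr (_ *: _); ring.
pose X := (6 * m)%:R *: (N *m N) - N.
have iX : X \is a intmx.
  by rewrite /X -scaleN1r !(intmxD, intmxZ) ?mxOverM ?rpredN ?rpred_nat ?rpred1.
have eS : inv_sqrt U = 1%:M + c *: X.
  rewrite /inv_sqrt UN -scalemxAl -scalemxAr /X.
  have -> : (6 * m)%:R = (3 / 2) * c by rewrite /c !natrM; field.
  by apply/matrixP => i j; rewrite !mx_linE; field.
clearbody X; exists (M + X + c *: (M *m X)).
  by apply: intmxD; [exact: intmxD | apply: intmxZ; [exact: rpred_nat | exact: mxOverM]].
rewrite eS egam mulmxDl !mulmxDr !mul1mx !mulmx1 -!scalemxAl -!scalemxAr.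
by apply/matrixP => i j; rewrite !mx_linE; ring.
Qed.

Lemma symplectic_int_inv p (gam : 'M[R]_(p + p)) : symplectic gam -> gam \is a intmx ->
  invmx gam \is a intmx.
Proof.
move=> sg ig; have u := symplectic_unit sg.
have -> : invmx gam = - Jmx R p *m gam^T *m Jmx R p.
  by rewrite -[RHS](mulmxK u) symplectic_mulVmx // mul1mx.
have iJ := Jmx_int R p.
have iNJ : - Jmx R p \is a intmx by rewrite -scaleN1r intmxZ // rpredN rpred1.
rewrite !mxOverM //; apply/mxOverP => i j; rewrite mxE; exact: mxOverP.
Qed.

Lemma scalemx_expr p (a : R) (A : 'M[R]_p) j : (a *: A) ^+ j = a ^+ j *: A ^+ j.
Proof.
elim: j => [|j IH]; first by rewrite !expr0 scale1r.
by rewrite !exprS IH -!mulmxE -scalemxAl -scalemxAr scalerA.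
Qed.

Lemma cube_intertwine p q (U : 'M[R]_p) (K : 'M[R]_q) (g : 'M[R]_(p, q)) :
  U *m g = g *m K -> U *m U *m U *m g = g *m (K *m K *m K).
Proof. by move=> Ug; rewrite -!mulmxA Ug (mulmxA U g) Ug -!mulmxA (mulmxA U g) Ug -!mulmxA. Qed.

Variables (k m : nat).
Local Notation n := (k + 1)%N.
Variables (g gam : 'M[R]_(n + n)).
Hypotheses (sg : symplectic g) (gQ : rational_mx g) (Ggam : in_Gamma m gam).

Let T := Dmx R n *m gam.
Let P := invmx g *m T *m g.

Let ug : g \in unitmx. Proof. exact: symplectic_unit. Qed.

Let gP : T *m g = g *m P. Proof. by rewrite /P !mulmxA mulmxV // mul1mx. Qed.

(** The vector [g e] is rational, so a multiple of it is an integral eigenvector of [T] and of its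
    integral inverse. Hence neither [a] nor [a^-1] has absolute value below [1]. *)
Lemma boundary_eigenvalue (a : R) : P *m evec R k = a *: evec R k -> a ^+ 2 = 1.
Proof.
move=> Pe; have [sgam [M iM egam]] := (in_GammaP m gam).1 Ggam.
have igam : gam \is a intmx.
  by rewrite egam intmxD ?intmxZ ?rpred_nat // mxOver_scalar ?rpred0 ?rpred1.
have iD := Dmx_int R n.
have ugam := symplectic_unit sgam.
have iTi : invmx gam *m Dmx R n \is a intmx by rewrite mxOverM // symplectic_int_inv.
have TiT : invmx gam *m Dmx R n *m T = 1%:M.
  by rewrite /T mulmxA -(mulmxA (invmx gam)) DmxK mulmx1 mulVmx.
pose v := g *m evec R k.
have Tv : T *m v = a *: v by rewrite mulmxA gP -mulmxA Pe -scalemxAr.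
have v0 : v != 0.
  apply/eqP => /(congr1 (mulmx (invmx g))); rewrite mulKmx // mulmx0 => e0.
  have := eTe R k; rewrite e0 mulmx0 => /matrixP/(_ 0 0)/eqP.
  by rewrite !mxE eqxx eq_sym oner_eq0.
have [c c0 icv] : exists2 c : R, c != 0 & c *: v \is a intmx.
  by apply: rational_clear_denominators => i; rewrite /v evecE -colE mxE; exact: gQ.
have a0 : a != 0.
  apply: contra v0 => /eqP a0.
  have : invmx gam *m Dmx R n *m (T *m v) = 0 by rewrite Tv a0 scale0r mulmx0.
  by rewrite mulmxA TiT mul1mx => ->.
have cv0 : c *: v != 0 by rewrite scaler_eq0 negb_or c0.
have ge1 : 1 <= `|a|.
  apply: (int_eigenvector_ge1 (T := T) _ icv) => //; first by rewrite mxOverM.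
  by rewrite -scalemxAr Tv !scalerA mulrC.
have ge1V : 1 <= `|a^-1|.
  apply: (int_eigenvector_ge1 iTi icv) => //; first by rewrite invr_eq0.
  rewrite -scalemxAr -[v in LHS](scalerK a0) -Tv -scalemxAr mulmxA TiT mul1mx !scalerA.
  by rewrite mulrC.
have : `|a| = 1.
  by apply/eqP; rewrite eq_le ge1 andbT -invf_ge1 ?normr_gt0 // -normfV.
by move=> na; rewrite -real_normK ?num_real // na expr1n.
Qed.

(** The matrix [L = K / 8m] is conjugate to an integral one, and its middle block is a contraction
    since [P ^+ 2] acts there as an isometry [kap]. So [L] is nilpotent, [kap] is a unipotent
    isometry and thus [1], and the middle block of [K] vanishes. *)
Lemma boundary_square_unipotent (a : R) (G : 'M[R]_(k + k)) : (0 < m)%N ->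
  P *m evec R k = a *: evec R k -> (fvec R k)^T *m P = - a *: (fvec R k)^T -> a ^+ 2 = 1 ->
  posdef G -> (let P1 := (incl R k)^T *m P *m incl R k in P1 *m G *m P1^T = G) ->
  let K := P *m P - 1%:M in K *m K *m K = 0 /\ (incl R k)^T *m K *m incl R k = 0.
Proof.
move=> m0 Pe fP a1 pG; set P1 := _ *m P *m _ => isoP K.
have [Ke fK] := corner_square Pe fP a1.
have [N iN TT] := Gamma_square Ggam; set c : R := (8 * m)%:R in TT.
have c8 : 8 <= c by rewrite /c ler_nat leq_pmulr.
have c0 : c != 0 by rewrite gt_eqF //; lra.
pose kap := P1 *m P1.
have isok : kap *m G *m kap^T = G.
  have -> : kap *m G *m kap^T = P1 *m (P1 *m G *m P1^T) *m P1^T by rewrite /kap trmx_mul !mulmxA.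
  by rewrite !isoP.
have eK : (incl R k)^T *m K *m incl R k = kap - 1%:M.
  by rewrite mulmxBr mulmxBl mulmx1 inclTincl (levi_mul Pe fP).
pose L := c^-1 *: K.
have Le : L *m evec R k = 0 by rewrite -scalemxAl Ke scaler0.
have fL : (fvec R k)^T *m L = 0 by rewrite -scalemxAr fK scaler0.
have eL : (incl R k)^T *m L *m incl R k = c^-1 *: (kap - 1%:M).
  by rewrite -scalemxAr -scalemxAl eK.
have NL : N *m g = g *m L.
  rewrite /L -scalemxAr mulmxBr mulmxA -gP -mulmxA -gP mulmxA TT mulmx1 mulmxDl mul1mx.
  by rewrite addrC addKr -scalemxAl scalerA mulVf // scale1r.
have NLj j : N ^+ j *m g = g *m L ^+ j.
  elim: j => [|j IH]; first by rewrite !expr0 mul1mx mulmx1.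
  by rewrite !exprS -!mulmxE -mulmxA IH mulmxA NL mulmxA.
have [j Nj] : exists j, N ^+ j.+2 = 0.
  apply: (int_isometry_nilpotent (A := g *m L *m incl R k)
    (B := (incl R k)^T *m L *m invmx g) iN pG isok c8) => j.
  rewrite -[LHS](mulmxK ug) NLj corner_expr // eL !mulmxA //.
have Lj : L ^+ j.+2 = 0.
  by rewrite -[LHS](mulKmx ug) -NLj Nj mul0mx mulmx0.
have kap1 : kap = 1%:M.
  apply: (isometry_unipotent (j := j.+1) pG isok).
  have : (c^-1 *: (kap - 1%:M)) ^+ j.+2 = 0.
    rewrite -eL exprS exprSr -!mulmxE; move: Lj; rewrite corner_expr //.
    move/(congr1 (fun X => (incl R k)^T *m X *m incl R k)); rewrite mulmx0 mul0mx => <-.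
    by rewrite !mulmxA.
  rewrite scalemx_expr => /eqP; rewrite scaler_eq0 expf_eq0 /= invr_eq0 (negPf c0) => /eqP //.
have w0 : (incl R k)^T *m K *m incl R k = 0 by rewrite eK kap1 subrr.
(* The cube of [K] contains its vanishing middle block as a factor. *)
split=> //; have := corner_expr 1 Ke fK; rewrite -/K w0 expr1 mulmx0 mul0mx.
by rewrite !exprS expr0 mulr1 -!mulmxE mulmxA.
Qed.

End Correction.

(* n = k + 1; F = g F_k is a rational boundary component of rank n - 1. *)
Theorem theorem9p2 (R : realType) (k m : nat) (hm : (0 < m)%N)
    (g : 'M[R]_((k + 1) + (k + 1))) (hg : symplectic g) (hgQ : rational_mx g)
    (gam : 'M[R]_((k + 1) + (k + 1))) (hgam : in_Gamma m gam)
    (hne : exists Z : 'M[complex R]_k, in_h Z /\ bd_fixed gam g Z) :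
  forall Z0 : 'M[complex R]_k, in_h Z0 -> bd_fixed gam g Z0 ->
    in_satake_closure m (h_union m (p := k + 1)) g Z0.
Proof.
move=> Z0 hZ0 [/stabFP[a he] fixZ0] eps t eps0.
have sgam := hgam.1; have ug := symplectic_unit hg.
have aT : antisymplectic (Dmx R (k + 1) *m gam) by apply: antisymplecticMr (Dmx_anti R _) sgam.
set T := Dmx R _ *m gam in aT; set h := invmx (tau_g g) *m _ in he fixZ0.
pose P := invmx g *m T *m g.
have gP : T *m g = g *m P by rewrite /P !mulmxA mulmxV // mul1mx.
(* As [tau(g) = D g D], the transition matrix [h] of the boundary condition is [D P]. *)
have PE : P = Dmx R (k + 1) *m h.
  have eT : tau_g g *m (Dmx R (k + 1) *m P) = gam *m g.
    by rewrite tau_gE -!mulmxA (mulmxA (Dmx R _) (Dmx R _) P) DmxK mul1mx -gP /T !mulmxA DmxK mul1mx.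
  have ut : tau_g g \in unitmx.
    rewrite tau_gE !unitmx_mul ug; have [-> _] := mulmx1_unit (DmxK R (k + 1)); by [].
  by rewrite /h -eT mulKmx // mulmxA DmxK mul1mx.
have Pe : P *m evec R k = a *: evec R k by rewrite PE -mulmxA he -scalemxAr De.
have a1 := boundary_eigenvalue hg hgQ hgam Pe.
have aP : antisymplectic P.
  by apply: antisymplecticMr => //; apply: antisymplecticMl => //; apply: symplectic_inv.
have fP := fT_antisymplectic aP Pe a1.
have P1E : (incl R k)^T *m P *m incl R k = Dmx R k *m levi h.
  by rewrite PE leviE !mulmxA inclTD.
have aP1 := levi_antisymplectic aP fP.
have sl : symplectic (levi h).
  have -> : levi h = Dmx R k *m ((incl R k)^T *m P *m incl R k) by rewrite P1E mulmxA DmxK mul1mx.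
  exact: antisymplecticM (Dmx_anti R k) aP1.
have fix1 : fixes_frame ((incl R k)^T *m P *m incl R k) Z0.
  by rewrite P1E; apply/fixes_frameP.
have [G [pG isoG]] := fixes_frame_isometry aP1 hZ0 fix1.
have [K3 w0] := boundary_square_unipotent hg hgam hm Pe fP a1 pG isoG.
set K := _ - 1%:M in K3 w0; pose U := T *m T - 1%:M.
have UK : U *m g = g *m K.
  by rewrite mulmxBl mulmxBr mul1mx mulmx1 -(mulmxA T T) gP (mulmxA T g) gP (mulmxA g P P).
have U3 : U *m U *m U = 0.
  by rewrite -[LHS](mulmxK ug) (cube_intertwine UK) K3 mulmx0 mul0mx.
(* Multiplying [T] by the inverse square root of [T ^+ 2] gives an involution; [P'] is this
   involution in the coordinates of [g]. *)
pose gam' := gam *m inv_sqrt U; pose P' := P *m inv_sqrt K.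
have Ggam' : in_Gamma m gam' by apply: Gamma_inv_sqrt.
have gP' : Dmx R (k + 1) *m gam' *m g = g *m P'.
  by rewrite /gam' /P' (mulmxA _ gam) -/T -(mulmxA T) (inv_sqrt_intertwine UK) (mulmxA T) gP -(mulmxA g).
have [Ke fK] := corner_square Pe fP a1; rewrite -/K in Ke fK.
have KP : K *m P = P *m K by rewrite mulmxBl mulmxBr mul1mx mulmx1 (mulmxA P P P).
have PPK : P *m P = 1%:M + K by rewrite addrC subrK.
clearbody K.
have Se : inv_sqrt K *m evec R k = 1 *: evec R k.
  rewrite /inv_sqrt !mulmxDl mulNmx -!scalemxAl -mulmxA Ke mulmx0 !scaler0 mul1mx.
  by rewrite subr0 addr0 scale1r.
have fS : (fvec R k)^T *m inv_sqrt K = 1 *: (fvec R k)^T.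
  rewrite /inv_sqrt !mulmxDr mulmxN -!scalemxAr mulmxA fK mul0mx !scaler0 mulmx1.
  by rewrite subr0 addr0 scale1r.
have P'e : P' *m evec R k = a *: evec R k by rewrite /P' -mulmxA Se scale1r.
(* The correction is trivial on the middle block, so [P'] induces the same map on the boundary
   component as [P]. *)
have S1 : (incl R k)^T *m inv_sqrt K *m incl R k = 1%:M.
  have KK : (incl R k)^T *m (K *m K) *m incl R k = 0.
    by rewrite (levi_mul (a := 0) (b := 0)) ?w0 ?mul0mx // ?Ke ?fK scale0r.
  rewrite /inv_sqrt !mulmxDr !mulmxDl mulmxN mulNmx -!scalemxAr -!scalemxAl KK w0 !scaler0.
  by rewrite subr0 addr0 mulmx1 inclTincl.
have fix1' : fixes_frame ((incl R k)^T *m P' *m incl R k) Z0.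
  by rewrite (levi_mul Pe fS) S1 mulmx1.
have aP' : antisymplectic P'.
  have -> : P' = invmx g *m (Dmx R (k + 1) *m gam') *m g by rewrite -mulmxA gP' mulKmx.
  apply: antisymplecticMr => //; apply: antisymplecticMl; first exact: symplectic_inv.
  by apply: antisymplecticMr (Dmx_anti R _) Ggam'.1.
(* The correction is a polynomial in [K = P ^+ 2 - 1] and so commutes with [P]. *)
have PP' : P' *m P' = 1%:M.
  rewrite -(inv_sqrt_square K3) -PPK /P' -(mulmxA P (inv_sqrt K)) (mulmxA (inv_sqrt K) P).
  by rewrite (inv_sqrt_intertwine KP) -(mulmxA P (inv_sqrt K)) (mulmxA P P).
have [Z [hZ ulZ htZ fixZ]] := antisymplectic_involution_fixed t aP' PP' P'e a1 hZ0 fix1'.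
have s1 : symplectic (1%:M : 'M[R]_((k + 1) + (k + 1))).
  by rewrite /symplectic trmx1 mul1mx mulmx1.
(* The fixed point [Z] lies in the basic neighbourhood itself, so [delta] can be the identity. *)
exists 1%:M; split; last split.
- by apply/in_GammaP; split=> //; exists 0; rewrite ?scaler0 ?addr0 // mxOver0 ?rpred0.
- rewrite mul1mx /bd_eq mulVmx //; split; first by apply/stabFP; exists 1; rewrite mul1mx scale1r.
  rewrite leviE mulmx1 inclTincl; apply/esym.
  apply: (@sp_act_frameP _ _ _ _ _ 1%:M) => //; first by rewrite /symplectic trmx1 mul1mx mulmx1.
  by rewrite toCmx1 mul1mx mulmx1.
exists Z; split; first by split=> //; split=> // i j; rewrite ulZ subrr normr0 ltcE /= eqxx.
rewrite mul1mx; exists gam'; split=> //; split; first exact: sp_act_in_h.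
apply/fixes_frameP; [exact: Ggam'.1 | exact: sp_act_in_h | exact: fixes_frame_act gP' fixZ].
Qed.
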